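(* Let $(E,C)$ be a separated graph without isolated vertices and consider its associated inverse semigroup $\mathcal S(E,C)$. Let $K$ be a commutative ring with unit (endowed with an involution) and let $A$ be a $*$-algebra over $K$. Then a $*$-homomorphism $\pi\colon\mathcal S(E,C)\to A$ is tight if and only if it extends to a $*$-homomorphism $\mathcal L_K^{\mathrm{ab}}(E,C)\to A$ (i.e. $\pi$ is the composition of the canonical map $\mathcal S(E,C)\to\mathcal L_K^{\mathrm{ab}}(E,C)$ with a $*$-homomorphism of $K$-algebras $\mathcal L_K^{\mathrm{ab}}(E,C)\to A$).
   Context: A directed graph $E=(E^0,E^1,s,r)$ consists of sets $E^0$, $E^1$ (arbitrary cardinality) and maps $s,r\colon E^1\to E^0$. A separated graph $(E,C)$ is a directed graph with $C=\bigsqcup_{v}C_v$, where $C_v$ is a partition of $s^{-1}(v)$ into pairwise disjoint nonempty subsets ($C_v=\emptyset$ if $s^{-1}(v)=\emptyset$). A vertex $v$ is isolated if $s^{-1}(v)=r^{-1}(v)=\emptyset$. $E^{-1}=\{e^{-1}:e\in E^1\}$ is a set of formal inverses, $\hat E^1=E^1\sqcup E^{-1}$, $s(e^{-1})=r(e)$, $r(e^{-1})=s(e)$. $\mathcal S(E,C)$ is the universal inverse semigroup with zero generated by $E^0\cup\hat E^1$ subject to: (1) $vw=\delta_{v,w}v$ for $v,w\in E^0$; (2) $s(x)x=x$ and (3) $xr(x)=x$ for $x\in\hat E^1$; (4) $e^{-1}f=\delta_{e,f}r(e)$ for $e,f\in X$, $X\in C$. $K$ carries a fixed involution, and a $*$-algebra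 over $K$ is a $K$-algebra with a conjugate-linear anti-multiplicative involution $a\mapsto a^*$. The Leavitt path algebra $\mathcal L_K(E,C)$ is the universal $*$-algebra over $K$ generated by self-adjoint elements $v\in E^0$ and elements $e\in E^1$ subject to: (V) $vw=\delta_{v,w}v$; (E1) $s(e)e=e=er(e)$; (E2) $e^*s(e)=e^*=r(e)e^*$; (SCK1) $e^*f=\delta_{e,f}r(e)$ for $e,f\in X$, $X\in C$; (SCK2) $\sum_{e\in X}ee^*=v$ for every finite $X\in C_v$, $v\in E^0$. The tame Leavitt path algebra $\mathcal L_K^{\mathrm{ab}}(E,C)$ is the quotient of $\mathcal L_K(E,C)$ by the $*$-ideal generated by all commutators $[xx^*,yy^*]$ with $x,y$ in the multiplicative $*$-subsemigroup generated by $E^0\cup E^1$. The canonical map $\mathcal S(E,C)\to\mathcal L_K^{\mathrm{ab}}(E,C)$ sends $v\mapsto v$, $e\mapsto e$, $e^{-1}\mapsto e^*$. A $*$-homomorphism from an inverse semigroup $S$ with zero to a $*$-algebra $A$ is a multiplicative map $\pi\colon S\to A$ with $\pi(s^{-1})=\pi(s)^*$. Let $\mathcal E$ be the semilattice of idempotents of $S$. A cover of $p\in\mathcal E$ is a finite subset $Z\subseteq\{q\in\mathcal E:q\le p\}$ such that for all $0\ne q\le p$ there is $z\in Z$ with $zq\ne0$. $\pi$ is tight if for every $p\in\mathcal E$ and every finite cover $Z$ of $p$, $\bigvee_{z\in Z}\pi(z)=\pi(p)$ in the generalized Boolean algebra of idempotents of $A$ generated by $\pi(\mathcal E)$, with $p\wedge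 q=pq$, $p\vee q=p+q-pq$ (the empty join being $0$). *)

(* Defs.v *)
From HB Require Import structures.
From mathcomp Require Import all_boot all_algebra finmap.
From mathcomp Require Import all_classical.

Set Implicit Arguments.
Unset Strict Implicit.
Unset Printing Implicit Defensive.

Import GRing.Theory.

Local Open Scope classical_set_scope.
Local Open Scope quotient_scope.
Local Open Scope ring_scope.

(******************************************************************************)
(* Products in (inverse) semigroups and in *-algebras are both written        *)
(* (x * y)%g: this is the multiplication of MathComp's semigroupType.         *)
(* Algebras are not assumed to be unital.                                     *)
(******************************************************************************)

HB.mixin Record Semigroup_isInvSemigroup0 S of Semigroup S := {
  invs : S -> S;
  zeros : S;
  mulsVs : forall x : S, (x * invs x * x)%g = x;
  mulVsV : forall x : S, (invs x * x * invs x)%g = invs x;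
  invs_uniq : forall x y : S,
    (x * y * x)%g = x -> (y * x * y)%g = y -> y = invs x;
  mul0s : forall x : S, (zeros * x)%g = zeros;
  muls0 : forall x : S, (x * zeros)%g = zeros
}.

#[short(type="invSemigroup0Type")]
HB.structure Definition InvSemigroup0 :=
  {S of Semigroup_isInvSemigroup0 S & Semigroup S}.

Arguments zeros {s}.

Section InvSemigroup0Order.
Variable S : invSemigroup0Type.

Definition idems (p : S) : Prop := (p * p)%g = p.

Definition idem_le (q p : S) : Prop := (p * q)%g = q.

Definition idem_cover (p : S) (Z : {fset S}) : Prop :=
  (forall z, z \in Z -> idems z /\ idem_le z p) /\
  (forall q, idems q -> idem_le q p -> q <> zeros ->
     exists2 z, z \in Z & (z * q)%g <> zeros).

End InvSemigroup0Order.

HB.mixin Record Lmodule_isStarAlgebra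
    (K : comPzRingType) (conj : {rmorphism K -> K}) A
    of GRing.Lmodule K A & Semigroup A := {
  star : A -> A;
  samulDl : forall x y z : A, ((x + y)%R * z)%g = (x * z)%g + (y * z)%g;
  samulDr : forall x y z : A, (x * (y + z)%R)%g = (x * y)%g + (x * z)%g;
  samulZl : forall (k : K) (x y : A), ((k *: x)%R * y)%g = k *: (x * y)%g;
  samulZr : forall (k : K) (x y : A), (x * (k *: y)%R)%g = k *: (x * y)%g;
  starK : involutive star;
  starD : {morph star : x y / x + y};
  starZ : forall (k : K) (x : A), star (k *: x) = conj k *: star x;
  starM : forall x y : A, star (x * y)%g = (star y * star x)%g
}.

#[short(type="starAlgType")]
HB.structure Definition StarAlgebra
    (K : comPzRingType) (conj : {rmorphism K -> K}) :=
  {A of Lmodule_isStarAlgebra K conj A & GRing.Lmodule K A & Semigroup A}.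

Section StarAlgebraTheory.
Variables (K : comPzRingType) (conj : {rmorphism K -> K}) (A : starAlgType conj).
Implicit Types x y : A.

Lemma samul0l x : ((0%R : A) * x)%g = 0.
Proof. by have := samulZl 0 (0 : A) x; rewrite !scale0r. Qed.

Lemma samul0r x : (x * (0%R : A))%g = 0.
Proof. by have := samulZr 0 x (0 : A); rewrite !scale0r. Qed.

Lemma samulNl x y : ((- x)%R * y)%g = - (x * y)%g.
Proof. by rewrite -!scaleN1r samulZl. Qed.

Lemma samulNr x y : (x * (- y)%R)%g = - (x * y)%g.
Proof. by rewrite -!scaleN1r samulZr. Qed.

Lemma samulBl x y z : ((x - y)%R * z)%g = (x * z)%g - (y * z)%g.
Proof. by rewrite samulDl samulNl. Qed.

Lemma samulBr x y z : (x * (y - z)%R)%g = (x * y)%g - (x * z)%g.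
Proof. by rewrite samulDr samulNr. Qed.

Lemma star0 : star (0 : A) = 0.
Proof. by have := starZ 0 (0 : A); rewrite rmorph0 !scale0r. Qed.

Lemma starN x : star (- x) = - star x.
Proof. by rewrite -scaleN1r starZ rmorphN rmorph1 scaleN1r. Qed.

Lemma starB x y : star (x - y) = star x - star y.
Proof. by rewrite starD starN. Qed.

Definition commutator x y : A := (x * y)%g - (y * x)%g.

(* Join of commuting idempotents; the meet is the product. *)
Definition vee x y : A := x + y - (x * y)%g.

Inductive star_subsemigroup (G : set A) : A -> Prop :=
  | Ssub_gen x : G x -> star_subsemigroup G x
  | Ssub_mul x y : star_subsemigroup G x -> star_subsemigroup G y ->
      star_subsemigroup G (x * y)%g
  | Ssub_star x : star_subsemigroup G x -> star_subsemigroup G (star x).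

(* The *-ideal generated by G; closure under scalars has to be required since *)
(* A may have no unit.                                                        *)
Inductive star_ideal (G : set A) : A -> Prop :=
  | Sid_gen x : G x -> star_ideal G x
  | Sid_0 : star_ideal G 0
  | Sid_add x y : star_ideal G x -> star_ideal G y -> star_ideal G (x + y)
  | Sid_scale (k : K) x : star_ideal G x -> star_ideal G (k *: x)
  | Sid_mull x y : star_ideal G y -> star_ideal G (x * y)%g
  | Sid_mulr x y : star_ideal G x -> star_ideal G (x * y)%g
  | Sid_star x : star_ideal G x -> star_ideal G (star x).

End StarAlgebraTheory.

Definition star_alg_hom (K : comPzRingType) (conj : {rmorphism K -> K})
    (A B : starAlgType conj) (f : A -> B) : Prop :=
  [/\ linear f, forall x y, f (x * y)%g = (f x * f y)%g
    & forall x, f (star x) = star (f x)].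

(* No condition is put on the image of the zero element. *)
Definition star_sg_hom (S : invSemigroup0Type) (K : comPzRingType)
    (conj : {rmorphism K -> K}) (A : starAlgType conj) (pi : S -> A) : Prop :=
  (forall x y, pi (x * y)%g = (pi x * pi y)%g) /\
  (forall x, pi (invs x) = star (pi x)).

(* The idempotents pi p commute, so finite joins in the generalized Boolean   *)
(* algebra that they generate are iterated from vee, with empty join 0.       *)
Definition tight (S : invSemigroup0Type) (K : comPzRingType)
    (conj : {rmorphism K -> K}) (A : starAlgType conj) (pi : S -> A) : Prop :=
  forall (p : S) (Z : {fset S}), idems p -> idem_cover p Z ->
    \big[@vee K conj A/0]_(z <- Z) pi z = pi p.

Inductive iterm (X : Type) : Type :=
  | IGen of X
  | IZero
  | IMul of iterm X & iterm X
  | IInv of iterm X.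

Arguments IZero {X}.

HB.instance Definition _ (X : Type) := gen_eqMixin (iterm X).
HB.instance Definition _ (X : Type) := gen_choiceMixin (iterm X).

Section InvSemigroupPresentation.
Variables (X : Type) (R : iterm X -> iterm X -> Prop).

(* The least congruence containing R and the identities that define the       *)
(* variety of inverse semigroups with zero.                                   *)
Inductive icong : iterm X -> iterm X -> Prop :=
  | Icong_rel t u : R t u -> icong t u
  | Icong_refl t : icong t t
  | Icong_sym t u : icong t u -> icong u t
  | Icong_trans t u w : icong t u -> icong u w -> icong t w
  | Icong_mul t t' u u' : icong t t' -> icong u u' ->
      icong (IMul t u) (IMul t' u')
  | Icong_inv t t' : icong t t' -> icong (IInv t) (IInv t')
  | Icong_mulA t u w : icong (IMul t (IMul u w)) (IMul (IMul t u) w)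
  | Icong_mulVt t : icong (IMul (IMul t (IInv t)) t) t
  | Icong_invK t : icong (IInv (IInv t)) t
  | Icong_invM t u : icong (IInv (IMul t u)) (IMul (IInv u) (IInv t))
  | Icong_comm t u :
      icong (IMul (IMul t (IInv t)) (IMul u (IInv u)))
            (IMul (IMul u (IInv u)) (IMul t (IInv t)))
  | Icong_mul0t t : icong (IMul IZero t) IZero
  | Icong_mult0 t : icong (IMul t IZero) IZero.

Definition icongb (t u : iterm X) : bool := `[< icong t u >].

Lemma icongb_equiv : equiv_class_of icongb.
Proof.
split=> [t|t u|u t w].
- by apply/asboolP/Icong_refl.
- by apply/asboolP/asboolP; exact: Icong_sym.
- by move=> /asboolP tu /asboolP uw; apply/asboolP/(Icong_trans tu uw).
Qed.

Canonical icongb_eq := EquivRelPack icongb_equiv.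
Canonical icongb_enc := defaultEncModRel icongb.

Definition ipres : Type := {eq_quot icongb}.
HB.instance Definition _ := Choice.on ipres.

Definition icls (t : iterm X) : ipres := \pi_({eq_quot icongb}) t.
Definition irep (x : ipres) : iterm X := repr (x : {eq_quot icongb}).

Lemma irepK : cancel irep icls. Proof. exact: reprK. Qed.

Lemma iclsP t u : icls t = icls u <-> icong t u.
Proof.
split=> [/eqP|tu]; first by rewrite /icls piE => /asboolP.
by apply/eqP; rewrite /icls piE; apply/asboolP.
Qed.

Lemma irepP t : icong (irep (icls t)) t.
Proof. by apply/iclsP; rewrite irepK. Qed.

Definition ip_mul (x y : ipres) : ipres := icls (IMul (irep x) (irep y)).
Definition ip_inv (x : ipres) : ipres := icls (IInv (irep x)).

Lemma ip_mulE t u : ip_mul (icls t) (icls u) = icls (IMul t u).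
Proof. by apply/iclsP/Icong_mul; exact: irepP. Qed.

Lemma ip_invE t : ip_inv (icls t) = icls (IInv t).
Proof. by apply/iclsP/Icong_inv/irepP. Qed.

Lemma ip_mulA : associative ip_mul.
Proof.
move=> x y z; rewrite -[x]irepK -[y]irepK -[z]irepK !ip_mulE.
exact/iclsP/Icong_mulA.
Qed.

HB.instance Definition _ := isSemigroup.Build ipres ip_mulA.

Lemma iclsM t u : (icls t * icls u)%g = icls (IMul t u) :> ipres.
Proof. exact: ip_mulE. Qed.

Lemma ip_mulVs (x : ipres) : (x * ip_inv x * x)%g = x.
Proof.
by rewrite -[x]irepK ip_invE !iclsM; apply/iclsP/Icong_mulVt.
Qed.

Lemma ip_invK : involutive ip_inv.
Proof. by move=> x; rewrite -[x]irepK !ip_invE; apply/iclsP/Icong_invK. Qed.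

Lemma ip_invM (x y : ipres) : ip_inv (x * y)%g = (ip_inv y * ip_inv x)%g.
Proof.
by rewrite -[x]irepK -[y]irepK !(iclsM, ip_invE); apply/iclsP/Icong_invM.
Qed.

Lemma ip_comm (x y : ipres) :
  ((x * ip_inv x) * (y * ip_inv y) = (y * ip_inv y) * (x * ip_inv x))%g.
Proof.
by rewrite -[x]irepK -[y]irepK !(iclsM, ip_invE); apply/iclsP/Icong_comm.
Qed.

Lemma ip_mulVsV (x : ipres) : (ip_inv x * x * ip_inv x)%g = ip_inv x.
Proof. by have := ip_mulVs (ip_inv x); rewrite ip_invK. Qed.

Lemma ip_idemV (x : ipres) : (x * x = x)%g -> ip_inv x = x.
Proof.
move=> xx.
have VV : (ip_inv x * ip_inv x)%g = ip_inv x by rewrite -ip_invM xx.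
have : ip_inv x = (ip_inv x * x * (x * ip_inv x))%g.
  by rewrite mulgA -(mulgA _ x x) xx ip_mulVsV.
have := ip_comm (ip_inv x) x; rewrite ip_invK => -> ->.
by rewrite !mulgA -(mulgA x) VV ip_mulVs.
Qed.

Lemma ip_idemC (x y : ipres) :
  (x * x = x)%g -> (y * y = y)%g -> (x * y = y * x)%g.
Proof.
move=> xx yy; have := ip_comm x y.
by rewrite (ip_idemV xx) (ip_idemV yy) xx yy.
Qed.

Lemma ip_uniq (x y : ipres) : (x * y * x)%g = x -> (y * x * y)%g = y -> y = ip_inv x.
Proof.
move=> xyx yxy.
have i1 : ((y * x) * (y * x) = y * x)%g by rewrite mulgA yxy.
have i2 : ((ip_inv x * x) * (ip_inv x * x) = ip_inv x * x)%g.
  by rewrite mulgA ip_mulVsV.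
have i3 : ((x * y) * (x * y) = x * y)%g by rewrite mulgA xyx.
have i4 : ((x * ip_inv x) * (x * ip_inv x) = x * ip_inv x)%g.
  by rewrite mulgA ip_mulVs.
have -> : y = (ip_inv x * (x * y))%g.
  rewrite -{1}yxy -{1}(ip_mulVs x) -!mulgA.
  rewrite [(y * _)%g](_ : _ = ((y * x) * (ip_inv x * x) * y)%g); last first.
    by rewrite !mulgA.
  by rewrite (ip_idemC i1 i2) -!mulgA (mulgA y) yxy.
rewrite -{1}(ip_mulVsV x) -mulgA.
rewrite [X in X = _](_ : _ = (ip_inv x * ((x * ip_inv x) * (x * y)))%g); last first.
  by rewrite !mulgA.
by rewrite (ip_idemC i4 i3) !mulgA -(mulgA _ x y) -(mulgA _ _ x) xyx ip_mulVsV.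
Qed.

Lemma ip_mul0s (x : ipres) : (icls IZero * x)%g = icls IZero.
Proof. by rewrite -[x]irepK iclsM; apply/iclsP/Icong_mul0t. Qed.

Lemma ip_muls0 (x : ipres) : (x * icls IZero)%g = icls IZero.
Proof. by rewrite -[x]irepK iclsM; apply/iclsP/Icong_mult0. Qed.

HB.instance Definition _ := Semigroup_isInvSemigroup0.Build ipres
  ip_mulVs ip_mulVsV ip_uniq ip_mul0s ip_muls0.

Lemma iclsV t : invs (icls t : ipres) = icls (IInv t).
Proof. exact: ip_invE. Qed.

End InvSemigroupPresentation.

Fixpoint ieval (X T : Type) (zero : T) (mul : T -> T -> T) (inv : T -> T)
    (g : X -> T) (t : iterm X) : T :=
  match t with
  | IGen x => g x
  | IZero => zero
  | IMul t u => mul (ieval zero mul inv g t) (ieval zero mul inv g u)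
  | IInv t => inv (ieval zero mul inv g t)
  end.

Section InvSemigroup0Theory.
Variable S : invSemigroup0Type.
Implicit Types x y : S.

Lemma invsK : involutive (@invs S).
Proof. by move=> x; apply/esym/invs_uniq; rewrite (mulsVs, mulVsV). Qed.

Lemma idemV x : idems x -> invs x = x.
Proof. by move=> xx; apply/esym/invs_uniq; rewrite !xx. Qed.

Lemma idem_mulsV x : idems (x * invs x)%g.
Proof. by rewrite /idems mulgA mulsVs. Qed.

Lemma idem_mulVs x : idems (invs x * x)%g.
Proof. by rewrite /idems mulgA mulVsV. Qed.

Lemma idem_mul x y : idems x -> idems y -> idems (x * y)%g.
Proof.
move=> xx yy; pose u := invs (x * y)%g.
have e1 : (x * y * u * (x * y) = x * y)%g by exact: mulsVs.
have e2 : (u * (x * y) * u = u)%g by exact: mulVsV.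
have e : (y * u * x)%g = u.
  apply: invs_uniq; rewrite !mulgA.
    by rewrite -(mulgA x y y) yy -(mulgA _ x x) xx -[RHS]e1 !mulgA.
  by rewrite -(mulgA _ x x) xx -(mulgA _ y y) yy -[in RHS]e2 !mulgA.
have iu : idems u.
  by rewrite /idems -[in LHS]e -[RHS]e -[in RHS]e2 !mulgA.
have -> : (x * y)%g = invs u by rewrite invsK.
by rewrite (idemV iu).
Qed.

Lemma idemC x y : idems x -> idems y -> (x * y = y * x)%g.
Proof.
move=> xx yy; have ixy := idem_mul xx yy; have iyx := idem_mul yy xx.
rewrite -[LHS](idemV ixy); apply/esym/invs_uniq; rewrite !mulgA.
  by rewrite -(mulgA x y y) yy -(mulgA _ x x) xx -[RHS]ixy !mulgA.
by rewrite -(mulgA y x x) xx -(mulgA _ y y) yy -[RHS]iyx !mulgA.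
Qed.

Lemma invsM x y : invs (x * y)%g = (invs y * invs x)%g.
Proof.
have c := idemC (idem_mulsV y) (idem_mulVs x).
apply/esym/invs_uniq.
  have -> : (x * y * (invs y * invs x) * (x * y)
             = x * (y * invs y * (invs x * x)) * y)%g by rewrite !mulgA.
  by rewrite c !mulgA mulsVs -!mulgA (mulgA y) mulsVs.
have -> : (invs y * invs x * (x * y) * (invs y * invs x)
           = invs y * (invs x * x * (y * invs y)) * invs x)%g by rewrite !mulgA.
by rewrite -c !mulgA mulVsV -!mulgA (mulgA (invs x)) mulVsV.
Qed.

Lemma invs0 : invs (zeros : S) = zeros.
Proof. by apply/esym/invs_uniq; rewrite !mul0s. Qed.

End InvSemigroup0Theory.

Theorem ipres_universal (X : Type) (R : iterm X -> iterm X -> Prop)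
    (T : invSemigroup0Type) (g : X -> T) :
    let ev := ieval zeros (@monoid.mul T) (@invs T) g in
    (forall t u, R t u -> ev t = ev u) ->
  exists! f : ipres R -> T,
    [/\ forall x, f (icls R (IGen x)) = g x, f zeros = zeros,
        forall a b, f (a * b)%g = (f a * f b)%g
      & forall a, f (invs a) = invs (f a)].
Proof.
rewrite /=; set ev := ieval _ _ _ _ => Rev.
have sound t u : icong R t u -> ev t = ev u.
  rewrite /ev; elim=> {t u} [t u /Rev //|//|t u _ -> //|t u w _ -> _ //|||||||||] /=.
  - by move=> t t' u u' _ -> _ ->.
  - by move=> t t' _ ->.
  - by move=> t u w; rewrite mulgA.
  - by move=> t; rewrite mulsVs.
  - by move=> t; rewrite invsK.
  - by move=> t u; rewrite invsM.
  - by move=> t u; apply: idemC; exact: idem_mulsV.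
  - by move=> t; rewrite mul0s.
  - by move=> t; rewrite muls0.
exists (fun a => ev (irep a)); split.
  split=> [x||a b|a].
  - by rewrite (sound _ _ (irepP _ _)).
  - by rewrite (sound _ _ (irepP _ _)).
  - by rewrite (sound _ _ (irepP _ _)).
  - by rewrite (sound _ _ (irepP _ _)).
move=> f [fg f0 fM fV]; apply/funext => a; rewrite -[in RHS](irepK a).
elim: (irep a) => [x||t IHt u IHu|t IHt] //=.
- by rewrite -iclsM fM -IHt -IHu.
- by rewrite -iclsV fV -IHt.
Qed.

Inductive sterm (K X : Type) : Type :=
  | SGen of X
  | SZero
  | SAdd of sterm K X & sterm K X
  | SOpp of sterm K X
  | SScale of K & sterm K X
  | SMul of sterm K X & sterm K X
  | SStar of sterm K X.

Arguments SGen {K X} _.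
Arguments SZero {K X}.

HB.instance Definition _ (K X : Type) := gen_eqMixin (sterm K X).
HB.instance Definition _ (K X : Type) := gen_choiceMixin (sterm K X).

Section FreeStarAlgebra.
Variables (K : comPzRingType) (conj : {rmorphism K -> K}) (X : Type).
Local Notation T := (sterm K X).

Inductive scong : T -> T -> Prop :=
  | Scong_refl t : scong t t
  | Scong_sym t u : scong t u -> scong u t
  | Scong_trans t u w : scong t u -> scong u w -> scong t w
  | Scong_add t t' u u' : scong t t' -> scong u u' ->
      scong (SAdd t u) (SAdd t' u')
  | Scong_opp t t' : scong t t' -> scong (SOpp t) (SOpp t')
  | Scong_scale k t t' : scong t t' -> scong (SScale k t) (SScale k t')
  | Scong_mul t t' u u' : scong t t' -> scong u u' ->
      scong (SMul t u) (SMul t' u')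
  | Scong_star t t' : scong t t' -> scong (SStar t) (SStar t')
  | Scong_addA t u w : scong (SAdd t (SAdd u w)) (SAdd (SAdd t u) w)
  | Scong_addC t u : scong (SAdd t u) (SAdd u t)
  | Scong_add0 t : scong (SAdd SZero t) t
  | Scong_addN t : scong (SAdd (SOpp t) t) SZero
  | Scong_scaleA k l t : scong (SScale k (SScale l t)) (SScale (k * l) t)
  | Scong_scale1 t : scong (SScale 1 t) t
  | Scong_scaleDr k t u :
      scong (SScale k (SAdd t u)) (SAdd (SScale k t) (SScale k u))
  | Scong_scaleDl k l t :
      scong (SScale (k + l) t) (SAdd (SScale k t) (SScale l t))
  | Scong_mulA t u w : scong (SMul t (SMul u w)) (SMul (SMul t u) w)
  | Scong_mulDl t u w : scong (SMul (SAdd t u) w) (SAdd (SMul t w) (SMul u w))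
  | Scong_mulDr t u w : scong (SMul t (SAdd u w)) (SAdd (SMul t u) (SMul t w))
  | Scong_mulZl k t u : scong (SMul (SScale k t) u) (SScale k (SMul t u))
  | Scong_mulZr k t u : scong (SMul t (SScale k u)) (SScale k (SMul t u))
  | Scong_starK t : scong (SStar (SStar t)) t
  | Scong_starD t u : scong (SStar (SAdd t u)) (SAdd (SStar t) (SStar u))
  | Scong_starZ k t : scong (SStar (SScale k t)) (SScale (conj k) (SStar t))
  | Scong_starM t u : scong (SStar (SMul t u)) (SMul (SStar u) (SStar t)).

Definition scongb (t u : T) : bool := `[< scong t u >].

Lemma scongb_equiv : equiv_class_of scongb.
Proof.
split=> [t|t u|u t w].
- by apply/asboolP/Scong_refl.
- by apply/asboolP/asboolP; exact: Scong_sym.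
- by move=> /asboolP tu /asboolP uw; apply/asboolP/(Scong_trans tu uw).
Qed.

Canonical scongb_eq := EquivRelPack scongb_equiv.
Canonical scongb_enc := defaultEncModRel scongb.

Definition free_star : Type := {eq_quot scongb}.
HB.instance Definition _ := Choice.on free_star.

Definition scls (t : T) : free_star := \pi_({eq_quot scongb}) t.
Definition srep (x : free_star) : T := repr (x : {eq_quot scongb}).

Lemma srepK : cancel srep scls. Proof. exact: reprK. Qed.

Lemma sclsP t u : scls t = scls u <-> scong t u.
Proof.
split=> [/eqP|tu]; first by rewrite /scls piE => /asboolP.
by apply/eqP; rewrite /scls piE; apply/asboolP.
Qed.

Lemma srepP t : scong (srep (scls t)) t.
Proof. by apply/sclsP; rewrite srepK. Qed.

Definition fs_add (x y : free_star) : free_star := scls (SAdd (srep x) (srep y)).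
Definition fs_opp (x : free_star) : free_star := scls (SOpp (srep x)).
Definition fs_scale k (x : free_star) : free_star := scls (SScale k (srep x)).
Definition fs_mul (x y : free_star) : free_star := scls (SMul (srep x) (srep y)).
Definition fs_star (x : free_star) : free_star := scls (SStar (srep x)).

Lemma fs_addE t u : fs_add (scls t) (scls u) = scls (SAdd t u).
Proof. by apply/sclsP/Scong_add; exact: srepP. Qed.
Lemma fs_oppE t : fs_opp (scls t) = scls (SOpp t).
Proof. by apply/sclsP/Scong_opp/srepP. Qed.
Lemma fs_scaleE k t : fs_scale k (scls t) = scls (SScale k t).
Proof. by apply/sclsP/Scong_scale/srepP. Qed.
Lemma fs_mulE t u : fs_mul (scls t) (scls u) = scls (SMul t u).
Proof. by apply/sclsP/Scong_mul; exact: srepP. Qed.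
Lemma fs_starE t : fs_star (scls t) = scls (SStar t).
Proof. by apply/sclsP/Scong_star/srepP. Qed.

Let fsE := (fs_addE, fs_oppE, fs_scaleE, fs_mulE, fs_starE).

Lemma fs_addA : associative fs_add.
Proof.
move=> x y z; rewrite -[x]srepK -[y]srepK -[z]srepK !fsE.
exact/sclsP/Scong_addA.
Qed.
Lemma fs_addC : commutative fs_add.
Proof.
by move=> x y; rewrite -[x]srepK -[y]srepK !fsE; apply/sclsP/Scong_addC.
Qed.
Lemma fs_add0 : left_id (scls SZero) fs_add.
Proof. by move=> x; rewrite -[x]srepK !fsE; apply/sclsP/Scong_add0. Qed.
Lemma fs_addN : left_inverse (scls SZero) fs_opp fs_add.
Proof. by move=> x; rewrite -[x]srepK !fsE; apply/sclsP/Scong_addN. Qed.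

HB.instance Definition _ :=
  GRing.isZmodule.Build free_star fs_addA fs_addC fs_add0 fs_addN.

Lemma sclsD t u : scls t + scls u = scls (SAdd t u).
Proof. exact: fs_addE. Qed.

Lemma fs_scaleA k l x : fs_scale k (fs_scale l x) = fs_scale (k * l) x.
Proof. by rewrite -[x]srepK !fsE; apply/sclsP/Scong_scaleA. Qed.
Lemma fs_scale1 : left_id 1 fs_scale.
Proof. by move=> x; rewrite -[x]srepK !fsE; apply/sclsP/Scong_scale1. Qed.
Lemma fs_scaleDr : right_distributive fs_scale +%R.
Proof.
move=> k x y; rewrite -[x]srepK -[y]srepK !(sclsD, fsE).
exact/sclsP/Scong_scaleDr.
Qed.
Lemma fs_scaleDl x : {morph fs_scale^~ x : k l / k + l}.
Proof.
by move=> k l; rewrite -[x]srepK !(sclsD, fsE); apply/sclsP/Scong_scaleDl.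
Qed.

HB.instance Definition _ := GRing.Zmodule_isLmodule.Build K free_star
  fs_scaleA fs_scale1 fs_scaleDr fs_scaleDl.

Lemma sclsZ k t : k *: scls t = scls (SScale k t).
Proof. exact: fs_scaleE. Qed.

Lemma fs_mulA : associative fs_mul.
Proof.
move=> x y z; rewrite -[x]srepK -[y]srepK -[z]srepK !fsE.
exact/sclsP/Scong_mulA.
Qed.

HB.instance Definition _ := isSemigroup.Build free_star fs_mulA.

Lemma sclsM t u : (scls t * scls u)%g = scls (SMul t u).
Proof. exact: fs_mulE. Qed.

Let sclsE := (sclsD, sclsZ, sclsM, fs_starE).

Lemma fs_mulDl (x y z : free_star) :
  ((x + y)%R * z)%g = (x * z)%g + (y * z)%g.
Proof.
rewrite -[x]srepK -[y]srepK -[z]srepK !sclsE.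
exact/sclsP/Scong_mulDl.
Qed.
Lemma fs_mulDr (x y z : free_star) :
  (x * (y + z)%R)%g = (x * y)%g + (x * z)%g.
Proof.
rewrite -[x]srepK -[y]srepK -[z]srepK !sclsE.
exact/sclsP/Scong_mulDr.
Qed.
Lemma fs_mulZl k (x y : free_star) : ((k *: x)%R * y)%g = k *: (x * y)%g.
Proof.
by rewrite -[x]srepK -[y]srepK !sclsE; apply/sclsP/Scong_mulZl.
Qed.
Lemma fs_mulZr k (x y : free_star) : (x * (k *: y)%R)%g = k *: (x * y)%g.
Proof.
by rewrite -[x]srepK -[y]srepK !sclsE; apply/sclsP/Scong_mulZr.
Qed.
Lemma fs_starK : involutive fs_star.
Proof. by move=> x; rewrite -[x]srepK !sclsE; apply/sclsP/Scong_starK. Qed.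
Lemma fs_starD : {morph fs_star : x y / x + y}.
Proof.
by move=> x y; rewrite -[x]srepK -[y]srepK !sclsE; apply/sclsP/Scong_starD.
Qed.
Lemma fs_starZ k x : fs_star (k *: x) = conj k *: fs_star x.
Proof. by rewrite -[x]srepK !sclsE; apply/sclsP/Scong_starZ. Qed.
Lemma fs_starM (x y : free_star) :
  fs_star (x * y)%g = (fs_star y * fs_star x)%g.
Proof.
by rewrite -[x]srepK -[y]srepK !sclsE; apply/sclsP/Scong_starM.
Qed.

HB.instance Definition _ := Lmodule_isStarAlgebra.Build K conj free_star
  fs_mulDl fs_mulDr fs_mulZl fs_mulZr fs_starK fs_starD fs_starZ fs_starM.

Lemma sclsS t : star (scls t : free_star) = scls (SStar t).
Proof. exact: fs_starE. Qed.

Definition sgen (x : X) : free_star := scls (SGen x).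

Theorem free_star_universal (A : starAlgType conj) (g : X -> A) :
  exists! f : free_star -> A, star_alg_hom f /\ forall x, f (sgen x) = g x.
Proof.
pose fix ev (t : T) : A :=
  match t with
  | SGen x => g x
  | SZero => 0
  | SAdd t u => ev t + ev u
  | SOpp t => - ev t
  | SScale k t => k *: ev t
  | SMul t u => (ev t * ev u)%g
  | SStar t => star (ev t)
  end.
have sound t u : scong t u -> ev t = ev u.
  elim=> {t u} //=.
  - by move=> t u w _ -> _ ->.
  - by move=> t t' u u' _ -> _ ->.
  - by move=> t t' _ ->.
  - by move=> k t t' _ ->.
  - by move=> t t' u u' _ -> _ ->.
  - by move=> t t' _ ->.
  - by move=> t u w; rewrite addrA.
  - by move=> t u; rewrite addrC.
  - by move=> t; rewrite add0r.
  - by move=> t; rewrite addNr.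
  - by move=> k l t; rewrite scalerA.
  - by move=> t; rewrite scale1r.
  - by move=> k t u; rewrite scalerDr.
  - by move=> k l t; rewrite scalerDl.
  - by move=> t u w; rewrite mulgA.
  - by move=> t u w; rewrite samulDl.
  - by move=> t u w; rewrite samulDr.
  - by move=> k t u; rewrite samulZl.
  - by move=> k t u; rewrite samulZr.
  - by move=> t; rewrite starK.
  - by move=> t u; rewrite starD.
  - by move=> k t; rewrite starZ.
  - by move=> t u; rewrite starM.
pose f (x : free_star) : A := ev (srep x).
have fE t : f (scls t) = ev t by exact/sound/srepP.
exists f; split.
  split=> [|x]; last exact: fE.
  split=> [k x y|x y|x].
  - by rewrite -[x]srepK -[y]srepK sclsZ sclsD !fE.
  - by rewrite -[x]srepK -[y]srepK sclsM !fE.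
  - by rewrite -[x]srepK sclsS !fE.
move=> h [[hl hM hS] hg]; apply/funext => x; rewrite -[x]srepK fE.
have h0 : h 0 = 0.
  have := hl 1 0 0; rewrite !scale1r addr0 => e.
  by apply: (@addrI _ (h 0)); rewrite -e addr0.
have hZ k y : h (k *: y) = k *: h y by rewrite -[k *: y]addr0 hl h0 addr0.
have hD y z : h (y + z) = h y + h z by rewrite -[y]scale1r hl !scale1r.
elim: (srep x) => [y||t IHt u IHu|t IHt|k t IHt|t IHt u IHu|t IHt] /=.
- by rewrite -hg.
- exact/esym/h0.
- by rewrite -sclsD hD IHt IHu.
- have <- : - scls t = scls (SOpp t) by exact: fs_oppE.
  by rewrite IHt -scaleN1r -hZ scaleN1r.
- by rewrite -sclsZ hZ IHt.
- by rewrite -sclsM hM IHt IHu.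
- by rewrite -sclsS hS IHt.
Qed.

End FreeStarAlgebra.

Section StarQuotient.
Variables (K : comPzRingType) (conj : {rmorphism K -> K}).
Variables (A : starAlgType conj) (G : set A).
Implicit Types x y z : A.

Definition qcongb x y : bool := `[< star_ideal G (x - y) >].

Lemma star_idealN x : star_ideal G x -> star_ideal G (- x).
Proof. by move=> Ix; rewrite -scaleN1r; exact: Sid_scale. Qed.

Lemma qcongb_equiv : equiv_class_of qcongb.
Proof.
have sym x y : qcongb x y -> qcongb y x.
  by move=> /asboolP /star_idealN; rewrite opprB => xy; exact/asboolP.
split=> [x|x y|y x z].
- by apply/asboolP; rewrite subrr; exact: Sid_0.
- by apply/idP/idP; exact: sym.
- move=> /asboolP xy /asboolP yz; apply/asboolP.
  by rewrite -[x](subrK y) -addrA; exact: Sid_add.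
Qed.

Canonical qcongb_eq := EquivRelPack qcongb_equiv.
Canonical qcongb_enc := defaultEncModRel qcongb.

Definition star_quot : Type := {eq_quot qcongb}.
HB.instance Definition _ := Choice.on star_quot.

Definition qcls x : star_quot := \pi_({eq_quot qcongb}) x.
Definition qrep (a : star_quot) : A := repr (a : {eq_quot qcongb}).

Lemma qrepK : cancel qrep qcls. Proof. exact: reprK. Qed.

Lemma qclsP x y : qcls x = qcls y <-> star_ideal G (x - y).
Proof.
split=> [/eqP|xy]; first by rewrite /qcls piE => /asboolP.
by apply/eqP; rewrite /qcls piE; apply/asboolP.
Qed.

Lemma qrepP x : star_ideal G (qrep (qcls x) - x).
Proof. by apply/qclsP; rewrite qrepK. Qed.

Definition sq_add (a b : star_quot) : star_quot := qcls (qrep a + qrep b).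
Definition sq_opp (a : star_quot) : star_quot := qcls (- qrep a).
Definition sq_scale k (a : star_quot) : star_quot := qcls (k *: qrep a).
Definition sq_mul (a b : star_quot) : star_quot := qcls (qrep a * qrep b)%g.
Definition sq_star (a : star_quot) : star_quot := qcls (star (qrep a)).

Lemma sq_addE x y : sq_add (qcls x) (qcls y) = qcls (x + y).
Proof. by apply/qclsP; rewrite opprD addrACA; apply: Sid_add; exact: qrepP. Qed.
Lemma sq_oppE x : sq_opp (qcls x) = qcls (- x).
Proof. by apply/qclsP; rewrite -opprD; apply/star_idealN/qrepP. Qed.
Lemma sq_scaleE k x : sq_scale k (qcls x) = qcls (k *: x).
Proof. by apply/qclsP; rewrite -scalerBr; apply/Sid_scale/qrepP. Qed.
Lemma sq_mulE x y : sq_mul (qcls x) (qcls y) = qcls (x * y)%g.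
Proof.
apply/qclsP; rewrite -[(qrep _ * _)%g](subrK (qrep (qcls x) * y)%g).
rewrite -samulBr -addrA -samulBl; apply: Sid_add.
  exact/Sid_mull/qrepP.
exact/Sid_mulr/qrepP.
Qed.
Lemma sq_starE x : sq_star (qcls x) = qcls (star x).
Proof. by apply/qclsP; rewrite -starB; apply/Sid_star/qrepP. Qed.

Let sqE := (sq_addE, sq_oppE, sq_scaleE, sq_mulE, sq_starE).

Lemma sq_addA : associative sq_add.
Proof.
by move=> a b c; rewrite -[a]qrepK -[b]qrepK -[c]qrepK !sqE addrA.
Qed.
Lemma sq_addC : commutative sq_add.
Proof. by move=> a b; rewrite -[a]qrepK -[b]qrepK !sqE addrC. Qed.
Lemma sq_add0 : left_id (qcls 0) sq_add.
Proof. by move=> a; rewrite -[a]qrepK !sqE add0r. Qed.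
Lemma sq_addN : left_inverse (qcls 0) sq_opp sq_add.
Proof. by move=> a; rewrite -[a]qrepK !sqE addNr. Qed.

HB.instance Definition _ :=
  GRing.isZmodule.Build star_quot sq_addA sq_addC sq_add0 sq_addN.

Lemma qclsD x y : qcls x + qcls y = qcls (x + y).
Proof. exact: sq_addE. Qed.
Lemma qcls0 : qcls 0 = 0. Proof. by []. Qed.
Lemma qclsN x : - qcls x = qcls (- x).
Proof. exact: sq_oppE. Qed.

Lemma sq_scaleA k l a : sq_scale k (sq_scale l a) = sq_scale (k * l) a.
Proof. by rewrite -[a]qrepK !sqE scalerA. Qed.
Lemma sq_scale1 : left_id 1 sq_scale.
Proof. by move=> a; rewrite -[a]qrepK !sqE scale1r. Qed.
Lemma sq_scaleDr : right_distributive sq_scale +%R.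
Proof.
by move=> k a b; rewrite -[a]qrepK -[b]qrepK !(qclsD, sqE) scalerDr.
Qed.
Lemma sq_scaleDl a : {morph sq_scale^~ a : k l / k + l}.
Proof. by move=> k l; rewrite -[a]qrepK !(qclsD, sqE) scalerDl. Qed.

HB.instance Definition _ := GRing.Zmodule_isLmodule.Build K star_quot
  sq_scaleA sq_scale1 sq_scaleDr sq_scaleDl.

Lemma qclsZ k x : k *: qcls x = qcls (k *: x).
Proof. exact: sq_scaleE. Qed.

Lemma sq_mulA : associative sq_mul.
Proof.
by move=> a b c; rewrite -[a]qrepK -[b]qrepK -[c]qrepK !sqE mulgA.
Qed.

HB.instance Definition _ := isSemigroup.Build star_quot sq_mulA.

Lemma qclsM x y : (qcls x * qcls y)%g = qcls (x * y)%g.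
Proof. exact: sq_mulE. Qed.

Let qclsE := (qclsD, qclsZ, qclsM, sq_starE).

Lemma sq_mulDl (a b c : star_quot) :
  ((a + b)%R * c)%g = (a * c)%g + (b * c)%g.
Proof. by rewrite -[a]qrepK -[b]qrepK -[c]qrepK !qclsE samulDl. Qed.
Lemma sq_mulDr (a b c : star_quot) :
  (a * (b + c)%R)%g = (a * b)%g + (a * c)%g.
Proof. by rewrite -[a]qrepK -[b]qrepK -[c]qrepK !qclsE samulDr. Qed.
Lemma sq_mulZl k (a b : star_quot) : ((k *: a)%R * b)%g = k *: (a * b)%g.
Proof. by rewrite -[a]qrepK -[b]qrepK !qclsE samulZl. Qed.
Lemma sq_mulZr k (a b : star_quot) : (a * (k *: b)%R)%g = k *: (a * b)%g.
Proof. by rewrite -[a]qrepK -[b]qrepK !qclsE samulZr. Qed.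
Lemma sq_starK : involutive sq_star.
Proof. by move=> a; rewrite -[a]qrepK !qclsE starK. Qed.
Lemma sq_starD : {morph sq_star : a b / a + b}.
Proof. by move=> a b; rewrite -[a]qrepK -[b]qrepK !qclsE starD. Qed.
Lemma sq_starZ k a : sq_star (k *: a) = conj k *: sq_star a.
Proof. by rewrite -[a]qrepK !qclsE starZ. Qed.
Lemma sq_starM (a b : star_quot) :
  sq_star (a * b)%g = (sq_star b * sq_star a)%g.
Proof. by rewrite -[a]qrepK -[b]qrepK !qclsE starM. Qed.

HB.instance Definition _ := Lmodule_isStarAlgebra.Build K conj star_quot
  sq_mulDl sq_mulDr sq_mulZl sq_mulZr sq_starK sq_starD sq_starZ sq_starM.

Lemma qclsS x : star (qcls x) = qcls (star x).
Proof. exact: sq_starE. Qed.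

Lemma qcls_hom : star_alg_hom (qcls : A -> star_quot).
Proof. by split=> [k x y|x y|x]; rewrite ?qclsZ ?qclsD ?qclsM ?qclsS. Qed.

Theorem star_quot_universal (B : starAlgType conj) (f : A -> B) :
    star_alg_hom f -> (forall x, G x -> f x = 0) ->
  exists! h : star_quot -> B, star_alg_hom h /\ forall x, h (qcls x) = f x.
Proof.
move=> [fl fM fS] fG.
have f0 : f 0 = 0.
  have := fl 1 0 0; rewrite !scale1r addr0 => e.
  by apply: (@addrI _ (f 0)); rewrite -e addr0.
have fZ k y : f (k *: y) = k *: f y by rewrite -[k *: y]addr0 fl f0 addr0.
have fD y z : f (y + z) = f y + f z by rewrite -[y]scale1r fl !scale1r.
have fI x : star_ideal G x -> f x = 0.
  elim=> {x} //=.
  - by move=> x y _ fx _ fy; rewrite fD fx fy addr0.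
  - by move=> k x _ fx; rewrite fZ fx scaler0.
  - by move=> x y _ fy; rewrite fM fy samul0r.
  - by move=> x y _ fx; rewrite fM fx samul0l.
  - by move=> x _ fx; rewrite fS fx star0.
have hE x : f (qrep (qcls x)) = f x.
  by rewrite -[qrep _](subrK x) fD (fI _ (qrepP x)) add0r.
exists (fun a => f (qrep a)); split.
  split=> [|x]; last exact: hE.
  split=> [k a b|a b|a].
  - by rewrite -[a]qrepK -[b]qrepK qclsZ qclsD !hE fl.
  - by rewrite -[a]qrepK -[b]qrepK qclsM !hE fM.
  - by rewrite -[a]qrepK qclsS !hE fS.
by move=> h [_ hq]; apply/funext => a; rewrite -[in RHS](qrepK a) hq.
Qed.

End StarQuotient.

(* The axioms of boolp put a choiceType structure on any type, so there is no *)
(* restriction on the sets of vertices and edges. sep_at v is the set C_v of  *)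
(* blocks; the library's partition requires the blocks to be nonempty.        *)
Record sep_graph : Type := SepGraph {
  vtx : choiceType;
  edg : choiceType;
  src : edg -> vtx;
  rng : edg -> vtx;
  sep_at : vtx -> set (set edg);
  sep_atP : forall v, partition (sep_at v) id (src @^-1` [set v])
}.

Arguments src {s}.
Arguments rng {s}.
Arguments sep_at {s}.

Definition isolated (E : sep_graph) (v : vtx E) : Prop :=
  src @^-1` [set v] = set0 /\ rng @^-1` [set v] = set0.

Definition sep (E : sep_graph) : set (set (edg E)) :=
  [set X | exists v, sep_at v X].

(* inl e is the edge e and inr e its formal inverse. *)
Definition dbl_edg (E : sep_graph) : Type := (edg E + edg E)%type.

Definition dsrc (E : sep_graph) (x : dbl_edg E) : vtx E :=
  match x with inl e => src e | inr e => rng e end.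

Definition drng (E : sep_graph) (x : dbl_edg E) : vtx E :=
  match x with inl e => rng e | inr e => src e end.

Section SepSemigroup.
Variable E : sep_graph.

Let T := iterm (vtx E + dbl_edg E).
Let v_ (v : vtx E) : T := IGen (inl v).
Let e_ (x : dbl_edg E) : T := IGen (inr x).

Inductive sep_isg_rel : T -> T -> Prop :=
  | Sisg_vertex v w :
      sep_isg_rel (IMul (v_ v) (v_ w)) (if v == w then v_ v else IZero)
  | Sisg_src x : sep_isg_rel (IMul (v_ (dsrc x)) (e_ x)) (e_ x)
  | Sisg_rng x : sep_isg_rel (IMul (e_ x) (v_ (drng x))) (e_ x)
  | Sisg_sep X e f : sep X -> X e -> X f ->
      sep_isg_rel (IMul (e_ (inr e)) (e_ (inl f)))
                  (if e == f then v_ (rng e) else IZero).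

Definition sep_isg : invSemigroup0Type := ipres sep_isg_rel.

Definition isg_vertex (v : vtx E) : sep_isg := icls sep_isg_rel (v_ v).
Definition isg_edge (x : dbl_edg E) : sep_isg := icls sep_isg_rel (e_ x).

End SepSemigroup.

Section Leavitt.
Variables (K : comPzRingType) (conj : {rmorphism K -> K}) (E : sep_graph).

Let F := free_star conj (vtx E + edg E).
Let v_ (v : vtx E) : F := sgen conj (inl v).
Let e_ (e : edg E) : F := sgen conj (inr e).

Inductive leavitt_rel : F -> F -> Prop :=
  | Lrel_selfadj v : leavitt_rel (star (v_ v)) (v_ v)
  | Lrel_V v w : leavitt_rel (v_ v * v_ w)%g (if v == w then v_ v else 0)
  | Lrel_E1l e : leavitt_rel (v_ (src e) * e_ e)%g (e_ e)
  | Lrel_E1r e : leavitt_rel (e_ e * v_ (rng e))%g (e_ e)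
  | Lrel_E2l e : leavitt_rel (star (e_ e) * v_ (src e))%g (star (e_ e))
  | Lrel_E2r e : leavitt_rel (v_ (rng e) * star (e_ e))%g (star (e_ e))
  | Lrel_SCK1 X e f : sep X -> X e -> X f ->
      leavitt_rel (star (e_ e) * e_ f)%g (if e == f then v_ (rng e) else 0)
  | Lrel_SCK2 v X : sep_at v X -> finite_set X ->
      leavitt_rel (\sum_(e \in X) (e_ e * star (e_ e))%g) (v_ v).

Definition leavitt : starAlgType conj :=
  star_quot [set d : F | exists x y, leavitt_rel x y /\ d = x - y].

Definition leavitt_cls (x : F) : leavitt := qcls _ x.
Definition leavitt_vertex (v : vtx E) : leavitt := leavitt_cls (v_ v).
Definition leavitt_edge (e : edg E) : leavitt := leavitt_cls (e_ e).

Definition leavitt_sg : set leavitt :=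
  star_subsemigroup (range leavitt_vertex `|` range leavitt_edge).

Definition tame_leavitt : starAlgType conj :=
  star_quot [set c : leavitt | exists x y, [/\ leavitt_sg x, leavitt_sg y
    & c = commutator (x * star x)%g (y * star y)%g]].

Definition tame_cls (x : leavitt) : tame_leavitt := qcls _ x.
Definition tame_vertex (v : vtx E) : tame_leavitt := tame_cls (leavitt_vertex v).
Definition tame_edge (e : edg E) : tame_leavitt := tame_cls (leavitt_edge e).

Definition tame_gen (g : vtx E + dbl_edg E) : tame_leavitt :=
  match g with
  | inl v => tame_vertex v
  | inr (inl e) => tame_edge e
  | inr (inr e) => star (tame_edge e)
  end.

Let ev : iterm (vtx E + dbl_edg E) -> tame_leavitt :=
  ieval 0 (@monoid.mul tame_leavitt) (@star K conj tame_leavitt) tame_gen.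

(* The canonical map. That it does not depend on the chosen representative    *)
(* is tame_canonE below.                                                      *)
Definition tame_canon (a : sep_isg E) : tame_leavitt := ev (irep a).

Lemma leavitt_cls_hom : star_alg_hom leavitt_cls.
Proof. exact: qcls_hom. Qed.

Lemma tame_cls_hom : star_alg_hom tame_cls.
Proof. exact: qcls_hom. Qed.

Let proj (x : F) : tame_leavitt := tame_cls (leavitt_cls x).

Let projM x y : proj (x * y)%g = (proj x * proj y)%g.
Proof. by rewrite /proj /tame_cls /leavitt_cls -qclsM -qclsM. Qed.

Let projS x : proj (star x) = star (proj x).
Proof. by rewrite /proj /tame_cls /leavitt_cls -qclsS -qclsS. Qed.

Let proj0 : proj 0 = 0. Proof. by []. Qed.

Let proj_rel x y : leavitt_rel x y -> proj x = proj y.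
Proof.
move=> xy; rewrite /proj; congr tame_cls; apply/qclsP/Sid_gen.
by exists x, y.
Qed.

Let U : set tame_leavitt := star_subsemigroup (range tame_vertex `|` range tame_edge).

Let U_lift a : U a -> exists2 x, leavitt_sg x & tame_cls x = a.
Proof.
elim=> {a} [a [[v _ <-]|[e _ <-]]|a b _ [x Ux <-] _ [y Uy <-]|a _ [x Ux <-]].
- by exists (leavitt_vertex v) => //; apply: Ssub_gen; left; exists v.
- by exists (leavitt_edge e) => //; apply: Ssub_gen; right; exists e.
- by exists (x * y)%g; [exact: Ssub_mul|rewrite /tame_cls -qclsM].
- by exists (star x); [exact: Ssub_star|rewrite /tame_cls -qclsS].
Qed.

Let U_comm a b : U a -> U b ->
  ((a * star a) * (b * star b) = (b * star b) * (a * star a))%g.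
Proof.
move=> /U_lift[x Ux <-] /U_lift[y Uy <-].
have [_ tM tS] := tame_cls_hom.
rewrite -!tS -!tM; apply/qclsP/Sid_gen.
by exists x, y; split.
Qed.

Let edge_sep e : exists2 X : set (edg E), sep X & X e.
Proof.
have [cov _ _] := sep_atP (src e).
have : cover (sep_at (src e)) id e by rewrite cov.
by move=> [X CX Xe]; exists X => //; exists (src e).
Qed.

Let U_pi a : U a -> (a * star a * a)%g = a.
Proof.
elim=> {a} [a [[v _ <-]|[e _ <-]]|a b Ua IHa Ub IHb|a _ IHa].
- rewrite -[tame_vertex v]/(proj (v_ v)) -projS (proj_rel (Lrel_selfadj v)).
  by rewrite -!projM projM (proj_rel (Lrel_V v v)) eqxx -projM
    (proj_rel (Lrel_V v v)) eqxx.
- have [X CX Xe] := edge_sep e.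
  rewrite -[tame_edge e]/(proj (e_ e)) -projS -mulgA.
  rewrite -[(proj (star _) * _)%g]projM.
  by rewrite (proj_rel (Lrel_SCK1 CX Xe Xe)) eqxx -projM (proj_rel (Lrel_E1r e)).
- have c := U_comm Ub (Ssub_star Ua); rewrite starK in c.
  have -> : (a * b * star (a * b) * (a * b)
             = a * (b * star b * (star a * a)) * b)%g by rewrite starM !mulgA.
  by rewrite c !mulgA IHa -!mulgA (mulgA b) IHb.
- by rewrite -{2}[a]starK -!starM mulgA starK IHa.
Qed.

Let ev_U t : ev t = 0 \/ U (ev t).
Proof.
elim: t => [[v|[e|e]]||t [t0|Ut] u [u0|Uu]|t [t0|Ut]]; rewrite /ev /=.
- by right; apply: Ssub_gen; left; exists v.
- by right; apply: Ssub_gen; right; exists e.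
- by right; apply/Ssub_star/Ssub_gen; right; exists e.
- by left.
- by left; rewrite -/(ev t) t0 samul0l.
- by left; rewrite -/(ev t) t0 samul0l.
- by left; rewrite -/(ev u) u0 samul0r.
- by right; exact: Ssub_mul.
- by left; rewrite -/(ev t) t0 star0.
- by right; exact: Ssub_star.
Qed.

Let ev_sound t u : icong (@sep_isg_rel E) t u -> ev t = ev u.
Proof.
rewrite /ev; elim=> {t u} [t u|//|t u _ -> //|t u w _ -> _ //|||||||||] /=.
- case=> {t u} [v w|[e|e]|[e|e]|X e f CX Xe Xf] /=.
  + rewrite -[tame_vertex v]/(proj (v_ v)) -[tame_vertex w]/(proj (v_ w)).
    by rewrite -projM (proj_rel (Lrel_V v w)); case: eqP.
  + rewrite -[tame_vertex _]/(proj (v_ _)) -[tame_edge e]/(proj (e_ e)).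
    by rewrite -projM (proj_rel (Lrel_E1l e)).
  + rewrite -[tame_vertex _]/(proj (v_ _)) -[tame_edge e]/(proj (e_ e)).
    by rewrite -projS -projM (proj_rel (Lrel_E2r e)).
  + rewrite -[tame_vertex _]/(proj (v_ _)) -[tame_edge e]/(proj (e_ e)).
    by rewrite -projM (proj_rel (Lrel_E1r e)).
  + rewrite -[tame_vertex _]/(proj (v_ _)) -[tame_edge e]/(proj (e_ e)).
    by rewrite -projS -projM (proj_rel (Lrel_E2l e)).
  + rewrite -[tame_edge e]/(proj (e_ e)) -[tame_edge f]/(proj (e_ f)).
    by rewrite -projS -projM (proj_rel (Lrel_SCK1 CX Xe Xf)); case: eqP.
- by move=> t t' u u' _ -> _ ->.
- by move=> t t' _ ->.
- by move=> t u w; rewrite mulgA.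
- move=> t; rewrite -/(ev t); have [->|Ut] := ev_U t; last exact: U_pi.
  by rewrite samul0r.
- by move=> t; rewrite starK.
- by move=> t u; rewrite starM.
- move=> t u; rewrite -/(ev t) -/(ev u).
  have [->|Ut] := ev_U t; first by rewrite !(samul0l, samul0r).
  have [->|Uu] := ev_U u; first by rewrite !(samul0l, samul0r).
  exact: U_comm.
- by move=> t; rewrite samul0l.
- by move=> t; rewrite samul0r.
Qed.

Lemma tame_canonE t : tame_canon (icls (@sep_isg_rel E) t) = ev t.
Proof. by apply: ev_sound; exact: irepP. Qed.

Lemma tame_canon_hom : star_sg_hom tame_canon.
Proof.
split=> [a b|a].
- by rewrite -[a]irepK -[b]irepK iclsM !tame_canonE.
- by rewrite -[a]irepK iclsV !tame_canonE.
Qed.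

Lemma tame_canon0 : tame_canon zeros = 0.
Proof. exact: (tame_canonE IZero). Qed.

Lemma tame_canon_vertex v : tame_canon (isg_vertex v) = tame_vertex v.
Proof. exact: tame_canonE. Qed.

Lemma tame_canon_edge e : tame_canon (isg_edge (inl e)) = tame_edge e.
Proof. exact: tame_canonE. Qed.

Lemma tame_canon_edgeV e :
  tame_canon (isg_edge (inr e)) = star (tame_edge e).
Proof. exact: tame_canonE. Qed.

End Leavitt.

(* Main.v *)
Require Import Defs.
From mathcomp Require Import all_boot all_algebra.
From mathcomp Require Import finmap all_classical.

Set Implicit Arguments.
Unset Strict Implicit.
Unset Printing Implicit Defensive.

Import GRing.Theory.

Local Open Scope classical_set_scope.

(** Write p_w = w w^-1 for a path w, possibly not reduced. Every element of the
    semigroup is zero or a path, so every nonzero idempotent is some p_w, and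
    p_w only depends on the tree that w explores: a step along an inverse edge
    is free because e^-1 e is a vertex, whereas a step along an edge e selects e
    in its block, and two selections in the same block at the same place give
    zero.

    A homomorphism that extends to the tame algebra sends zero to 0 and sends
    each vertex v to the sum of the images of the e e^-1, for e in a finite
    block at v ([tame_sck2]). Conversely these two properties suffice to build
    the extension from the universal properties, since the commutators vanish on
    the image of an inverse semigroup ([tame_extension]). So the theorem says
    that tightness is equivalent to these two properties.

    Tightness implies them because the empty set covers zero and because the
    idempotents e e^-1 of a finite block at v cover v ([block_cover]). The second
    fact requires certain products in a presented semigroup to be nonzero. The
    tool is [separating_character]: for an idempotent q <> 0 the relations let q
    act on the infinite trees that choose one edge in every block at every
    place. Choosing the tree so that it contains the one of q gives a character
    chi with chi q which is total on the blocks, and the choices that q leaves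
    free can be made outside any given finite set of edges.

    For the converse, let Z cover p and let J be the join of the images of Z. It
    is enough to show that pi q J = pi q for every idempotent q such that each
    nonzero idempotent below q meets Z ([cover_fix]). This holds if q lies below
    an element of Z. Otherwise each z in Z that meets q leaves the tree of q
    through some block. If one of these blocks is finite, q is split along it
    with the relation for finite blocks ([refine]) and every piece is closer to
    the elements of Z ([refine_cost]). If they are all infinite, a character that
    contains q and selects other edges there yields a nonzero idempotent below q
    that is disjoint from Z ([avoid]), which is impossible. *)

(** * Range idempotents *)

Section RangeIdempotents.
Variable S : invSemigroup0Type.
Implicit Types a b p q : S.
Local Open Scope group_scope.

(** Locked, so that reassociating a product does not open [ran a]. *)
Definition ran a : S := locked (a * invs a).

Lemma ranE a : ran a = a * invs a.
Proof. by rewrite /ran -lock. Qed.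

Lemma idem_ran a : idems (ran a).
Proof. by rewrite ranE; exact: idem_mulsV. Qed.

Lemma idem_ranE q : idems q -> ran q = q.
Proof. by move=> qq; rewrite ranE (idemV qq). Qed.

Lemma ran0 : ran zeros = zeros.
Proof. by rewrite ranE mul0s. Qed.

Lemma ranM a b : ran (a * b) = a * ran b * invs a.
Proof. by rewrite !ranE invsM !mulgA. Qed.

Lemma idem_leE q p : idems q -> idems p -> idem_le q p <-> q * p = q.
Proof. by move=> qq pp; rewrite /idem_le (idemC pp qq). Qed.

Lemma ran_mull a b : ran a * ran (a * b) = ran (a * b).
Proof. by rewrite ranM !ranE !mulgA mulsVs. Qed.

Lemma le_ran_mull q a b : q * ran (a * b) = q -> q * ran a = q.
Proof.
move=> e; rewrite -[in LHS]e -mulgA (idemC (idem_ran _) (idem_ran a)).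
by rewrite ran_mull.
Qed.

Lemma eq_ran q a b : idems q -> q * a = q * b -> q * ran a = q * ran b.
Proof.
move=> qq ab.
have E c : q * ran c = ran (q * c).
  by rewrite ranM (idemV qq) -(mulgA q) (idemC (idem_ran c) qq) (mulgA q q) qq.
by rewrite !E ab.
Qed.

(** Multiplication by an element below [ran (a * b)] makes the factor
    [ran b] behind [a] invisible, since [ran b] commutes with [invs a * a]. *)
Lemma mul_ran_absorb q a b : q * ran (a * b) = q -> q * a = q * a * ran b.
Proof.
move=> e; rewrite -[in LHS]e -[in RHS]e ranM.
have c := idemC (idem_mulVs a) (idem_ran b).
have rb : ran b * ran b = ran b by exact: idem_ran.
have -> : q * (a * ran b * invs a) * a = q * a * (ran b * (invs a * a)).
  by rewrite !mulgA.
by rewrite -c -!mulgA rb.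
Qed.

Lemma mul_ran_eq0 a b c : invs b * c = zeros -> ran (a * b) * ran (a * c) = zeros.
Proof.
move=> bc; rewrite !ranM.
have -> : a * ran b * invs a * (a * ran c * invs a)
          = a * (ran b * (invs a * a)) * ran c * invs a by rewrite !mulgA.
rewrite -(idemC (idem_mulVs a) (idem_ran b)) -!mulgA.
have -> : ran b * (ran c * invs a) = b * (invs b * c) * (invs c * invs a).
  by rewrite !ranE !mulgA.
by rewrite bc !(mul0s, muls0).
Qed.

End RangeIdempotents.

(** * Paths in the inverse semigroup *)

Section Paths.
Variable E : sep_graph.
Local Notation S := (sep_isg E).
Local Notation V := (isg_vertex (E := E)).
Local Notation G := (isg_edge (E := E)).
Local Notation word := (seq (dbl_edg E)).
Implicit Types (v u : vtx E) (w : word) (e f : edg E) (x : dbl_edg E).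
Local Open Scope group_scope.

Definition flip x : dbl_edg E :=
  match x with inl e => inr e | inr e => inl e end.

Lemma sep_src v X e : sep_at v X -> X e -> src e = v.
Proof.
move=> vX Xe; have [cov _ _] := sep_atP v.
suff : (src @^-1` [set v]) e by [].
by rewrite -cov; exists X.
Qed.

Lemma edge_block e : exists2 X : set (edg E), sep_at (src e) X & X e.
Proof.
have [cov _ _] := sep_atP (src e).
have : cover (sep_at (src e)) id e by rewrite cov.
by move=> [X CX Xe]; exists X.
Qed.

Lemma block_uniq X Y e : sep X -> sep Y -> X e -> Y e -> X = Y.
Proof.
move=> [v vX] [u uY] Xe Ye; have vu : v = u.
  by rewrite -(sep_src vX Xe) (sep_src uY Ye).
move: vX; rewrite vu => uX; have [_ triv _] := sep_atP u.
by apply: triv => //; exists e.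
Qed.

Lemma isg_vertexM v u : V v * V u = if v == u then V v else zeros.
Proof.
rewrite /isg_vertex iclsM.
transitivity (icls (@sep_isg_rel E) (if v == u then IGen (inl v) else IZero)).
  exact/iclsP/Icong_rel/Sisg_vertex.
by case: eqP.
Qed.

Lemma isg_srcM x : V (dsrc x) * G x = G x.
Proof. by rewrite /isg_vertex /isg_edge iclsM; exact/iclsP/Icong_rel/Sisg_src. Qed.

Lemma isg_rngM x : G x * V (drng x) = G x.
Proof. by rewrite /isg_vertex /isg_edge iclsM; exact/iclsP/Icong_rel/Sisg_rng. Qed.

Lemma isg_sepM X e f : sep X -> X e -> X f ->
  G (inr e) * G (inl f) = if e == f then V (rng e) else zeros.
Proof.
move=> sX Xe Xf; rewrite /isg_edge iclsM.
transitivity (icls (@sep_isg_rel E) (if e == f then IGen (inl (rng e)) else IZero)).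
  exact/iclsP/Icong_rel/(Sisg_sep sX Xe Xf).
by case: eqP.
Qed.

Lemma isg_edgeVM e : G (inr e) * G (inl e) = V (rng e).
Proof.
have [X vX Xe] := edge_block e.
by rewrite (@isg_sepM X e e) ?eqxx //; exists (src e).
Qed.

Lemma idem_vertex v : idems (V v).
Proof. by rewrite /idems isg_vertexM eqxx. Qed.

(** The presentation introduces [inr e] as a generator of its own; that it is
    the inverse of [inl e] is a consequence of the relations. *)
Lemma invs_edge x : invs (G x) = G (flip x).
Proof.
have edgeV e : G (inr e) = invs (G (inl e)).
  apply: invs_uniq; first by rewrite -mulgA isg_edgeVM (isg_rngM (inl e)).
  by rewrite isg_edgeVM (isg_srcM (inr e)).
by case: x => e /=; rewrite edgeV // invsK.
Qed.

(** Words are read backwards: the head of the list is the last letter of the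
    path, so that a step in the tree of paths only changes the head. *)
Fixpoint pth v w : S := if w is x :: w' then pth v w' * G x else V v.

Definition pend v w : vtx E := if w is x :: _ then drng x else v.

Lemma pth_end v w : pth v w * V (pend v w) = pth v w.
Proof.
by case: w => [|x w] /=; [exact: idem_vertex|rewrite -mulgA isg_rngM].
Qed.

Lemma pth_start v w : V v * pth v w = pth v w.
Proof. by elim: w => [|x w IHw] /=; [exact: idem_vertex|rewrite mulgA IHw]. Qed.

Lemma pth_cons_eq0 v w x : pend v w <> dsrc x -> pth v (x :: w) = zeros.
Proof.
move=> /eqP/negbTE ne; rewrite /= -pth_end -isg_srcM -mulgA.
by rewrite [V _ * (_ * _)]mulgA isg_vertexM ne !(mul0s, muls0).
Qed.

Lemma pthM v w u w' : exists w'',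
  pth v w * pth u w' = zeros \/ pth v w * pth u w' = pth v w''.
Proof.
elim: w' => [|x w' [w'' IH]] /=.
  exists w; rewrite -pth_end -mulgA isg_vertexM.
  by case: eqP => _; [right|left; rewrite muls0].
exists (x :: w''); rewrite mulgA.
by case: IH => ->; [left; rewrite mul0s|right].
Qed.

Lemma isg_pth (s : S) : s = zeros \/ exists v w, s = pth v w.
Proof.
have mulP (a b : S) : a = zeros \/ (exists v w, a = pth v w) ->
    b = zeros \/ (exists v w, b = pth v w) ->
    a * b = zeros \/ (exists v w, a * b = pth v w).
  move=> [->|[v [w ->]]]; first by left; rewrite mul0s.
  move=> [->|[u [w' ->]]]; first by left; rewrite muls0.
  by have [w'' [e|e]] := pthM v w u w'; [left|right; exists v, w''].
have genP x : exists v w, G x = pth v w.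
  by exists (dsrc x), [:: x]; rewrite /= isg_srcM.
rewrite -[s]irepK; elim: (irep s) => [[v|x]||t IHt u IHu|t IHt].
- by right; exists v, [::].
- by right; exact: genP.
- by left.
- by rewrite -iclsM; exact: mulP.
- rewrite -iclsV; case: IHt => [->|[v [w ->]]]; first by left; rewrite invs0.
  elim: w => [|x w IHw] /=.
    by right; exists v, [::]; rewrite (idemV (idem_vertex v)).
  by rewrite invsM invs_edge; apply: mulP => //; right; exact: genP.
Qed.

Lemma idem_pth (q : S) : idems q -> q <> zeros -> exists v w, q = ran (pth v w).
Proof.
move=> qq q0; have [//|[v [w e]]] := isg_pth q.
by exists v, w; rewrite -e idem_ranE.
Qed.

Lemma le_ran_cons (q : S) v w x :
  q * ran (pth v (x :: w)) = q -> q * ran (pth v w) = q.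
Proof. exact: le_ran_mull. Qed.

Lemma le_ran_composable (q : S) v w x : q <> zeros ->
  q * ran (pth v (x :: w)) = q -> pend v w = dsrc x.
Proof.
move=> q0 e; apply: contrapT => ne; apply: q0.
by rewrite -e pth_cons_eq0 // ran0 muls0.
Qed.

(** A step along an inverse edge costs nothing, because [e^-1 e] is the vertex
    at which that step starts. *)
Lemma ran_cons_inv v w e : pend v w = rng e ->
  ran (pth v (inr e :: w)) = ran (pth v w).
Proof.
move=> we; rewrite /= ranM [ran (G _)]ranE invs_edge /= isg_edgeVM -we.
by rewrite pth_end ranE.
Qed.

(** The way in which trees become incompatible: two selections in one block at
    the same place. *)
Lemma ran_block_disjoint v w X e f : sep X -> X e -> X f -> e <> f ->
  ran (pth v (inl e :: w)) * ran (pth v (inl f :: w)) = zeros.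
Proof.
move=> sX Xe Xf /eqP/negbTE ef; apply: mul_ran_eq0.
by rewrite invs_edge (isg_sepM sX) ?ef.
Qed.

End Paths.

(** * The tree of choices *)

Section Model.
Variable E : sep_graph.
Local Notation word := (seq (dbl_edg E)).
Variables (v0 : vtx E) (pick : word -> edg E -> Prop).
Hypothesis pick_ex : forall m X, sep_at (pend v0 m) X ->
  exists2 e, X e & pick m e.
Hypothesis pick_uniq : forall m X e f, sep X -> X e -> X f ->
  pick m e -> pick m f -> e = f.
Implicit Types (m n k : word) (e f : edg E).

(** The nodes of the tree that selects [pick m] at the place [m]. They are
    reduced words, and a word that arrived through the inverse of an edge [f]
    has already selected [f] in the block of [f]. The case [f = e] of the last
    condition on [inl e :: m'] is reducedness. *)
Fixpoint node m : Prop :=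
  match m with
  | [::] => True
  | inl e :: m' => [/\ node m', pend v0 m' = src e, pick m' e
      & forall f m'' X, m' = inr f :: m'' -> sep X -> X e -> X f -> False]
  | inr e :: m' => [/\ node m', pend v0 m' = rng e
      & forall m'', m' <> inl e :: m'']
  end.

(** An edge either extends the word or undoes a previous inverse edge. *)
Definition arrow e m n : Prop :=
  [/\ node m, node n & n = inl e :: m \/ m = inr e :: n].

Lemma arrow_src e m n : arrow e m n -> pend v0 m = src e.
Proof. by move=> [mm nn [nE|mE]]; [move: nn; rewrite nE; case|rewrite mE]. Qed.

Lemma arrow_rng e m n : arrow e m n -> pend v0 n = rng e.
Proof. by move=> [mm nn [nE|mE]]; [rewrite nE|move: mm; rewrite mE; case]. Qed.

(** A node has at most one outgoing edge in each block; this makes the relation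
    [e^-1 f = 0] hold for the action. *)
Lemma arrow_block e f X m n n' : sep X -> X e -> X f ->
  arrow e m n -> arrow f m n' -> e = f /\ n = n'.
Proof.
move=> sX Xe Xf [_ nn nE] [_ nn' nE'].
case: nE nE' nn nn' => [->|mE] [->|mE'].
- move=> /= [_ _ pe _] [_ _ pf _].
  by rewrite (pick_uniq sX Xe Xf pe pf).
- by move=> /= [_ _ _ H]; case: (H _ _ _ mE' sX Xe Xf).
- by move=> _ /= [_ _ _ H]; case: (H _ _ _ mE sX Xf Xe).
- by move: mE'; rewrite mE => -[-> ->].
Qed.

Lemma arrow_fun e m n n' : arrow e m n -> arrow e m n' -> n = n'.
Proof.
have [X vX Xe] := edge_block e; have sX : sep X by exists (src e).
by move=> a b; have [] := arrow_block sX Xe Xe a b.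
Qed.

Lemma arrow_inj e m m' n : arrow e m n -> arrow e m' n -> m = m'.
Proof.
move=> [mm _ nE] [mm' _ nE'].
case: nE nE' mm mm' => [nE|->] [nE'|->] //.
- by move: nE'; rewrite nE => -[->].
- by move=> _ /= [_ _ H]; case: (H _ nE).
- by move=> /= [_ _ H]; case: (H _ nE').
Qed.

(** This makes the relation [e^-1 e = r(e)] hold for the action. *)
Lemma arrow_onto e n : node n -> pend v0 n = rng e -> exists m, arrow e m n.
Proof.
move=> nn ne; have [[m nE]|H] := pselect (exists m, n = inl e :: m).
  by exists m; split=> //; [move: nn; rewrite nE; case|left].
exists (inr e :: n); split=> //; last by right.
by split=> // m nE; apply: H; exists m.
Qed.

Lemma arrow_complete m X : node m -> sep_at (pend v0 m) X ->
  (exists f n, X f /\ m = inr f :: n) \/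
  (exists f, [/\ X f, pick m f & arrow f m (inl f :: m)]).
Proof.
move=> mm mX; have [//|H] := pselect (exists f n, X f /\ m = inr f :: n).
  by left.
right; have [f Xf pf] := pick_ex mX; exists f; split=> //.
split=> //; last by left.
split=> //; first by rewrite (sep_src mX Xf).
move=> g n Y mE sY Yf Yg; apply: H; exists g, n; split=> //.
by rewrite (block_uniq _ sY Xf Yf) //; exists (pend v0 m).
Qed.

Definition act : iterm (vtx E + dbl_edg E) -> word -> word -> Prop :=
  ieval (fun _ _ => False)
    (fun r s m n => exists2 k, r m k & s k n)
    (fun r m n => r n m)
    (fun g m n => match g with
       | inl v => [/\ node m, m = n & pend v0 m = v]
       | inr (inl e) => arrow e m n
       | inr (inr e) => arrow e n m
       end).

(** Terms act as partial injections, so [IInv] is an inverse and the identities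
    of inverse semigroups hold. *)
Lemma act_fun_inj t :
  (forall m n n', act t m n -> act t m n' -> n = n') /\
  (forall m m' n, act t m n -> act t m' n -> m = m').
Proof.
rewrite /act; elim: t => [[v|[e|e]]||t [tf ti] u [uf ui]|t [tf ti]] /=.
- by split=> [m n n' [_ <- _] [_ <-]|m m' n [_ -> _] [_ ->]].
- split=> [m n n'|m m' n] a b; [exact: arrow_fun a b|exact: arrow_inj a b].
- split=> [m n n'|m m' n] a b; [exact: arrow_inj a b|exact: arrow_fun a b].
- by [].
- split=> [m n n' [k a b] [k' a' b']|m m' n [k a b] [k' a' b']].
    by move: b'; rewrite -(tf _ _ _ a a') => b'; exact: uf b b'.
  by move: a'; rewrite -(ui _ _ _ b b') => a'; exact: ti a a'.
- by split=> [m n n'|m m' n] a b; [exact: ti a b|exact: tf a b].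
Qed.

Lemma act_ran t m n : act (IMul t (IInv t)) m n <-> m = n /\ exists k, act t m k.
Proof.
have [_ ti] := act_fun_inj t; split=> [[k a b]|[<- [k a]]]; last by exists k.
by split; [exact: ti a b|exists k].
Qed.

Lemma act_sound t u : icong (@sep_isg_rel E) t u ->
  forall m n, act t m n <-> act u m n.
Proof.
elim=> {t u} [t u|//|t u _ tu|t u w _ tu _ uw|t t' u u' _ tt' _ uu'||||||||].
- case=> {t u} [v w|x|x|X e f sX Xe Xf] m n.
  + rewrite /act /=; split.
      by move=> [k [mm <- mv] [_ <- mw]]; rewrite -mv -mw eqxx.
    by case: eqVneq => //= vw [mm <- mv]; exists m; rewrite -?vw.
  + rewrite /act /=; split; first by move=> [k [mm <- _]].
    move=> a; exists m => //; case: x a => e a /=; split=> //.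
    * by case: a.
    * exact: arrow_src a.
    * by case: a.
    * exact: arrow_rng a.
  + rewrite /act /=; split; first by move=> [k a [_ <- _]].
    move=> a; exists n => //; case: x a => e a /=; split=> //.
    * by case: a.
    * exact: arrow_rng a.
    * by case: a.
    * exact: arrow_src a.
  + rewrite /act /=; split.
      move=> [k a b]; have [ef <-] := arrow_block sX Xe Xf a b.
      rewrite ef eqxx -ef; split=> //; first by case: a.
      exact: arrow_rng a.
    case: eqVneq => //= <- [mm <- me].
    by have [k a] := arrow_onto mm me; exists k.
- by move=> m n; rewrite tu.
- by move=> m n; rewrite tu.
- by move=> m n; split=> -[k /tt' a /uu' b]; exists k.
- by move=> t t' _ tt' m n; exact: tt'.
- move=> t u w m n; split=> [[k a [l b c]]|[k [l a b] c]].
    by exists l => //; exists k.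
  by exists l => //; exists k.
- move=> t m n; split=> [[k /act_ran[<- _]]//|a].
  by exists m => //; apply/act_ran; split=> //; exists n.
- by [].
- by move=> t u m n; split=> -[k a b]; exists k.
- move=> t u m n; split=> -[k /act_ran[<- a] /act_ran[<- b]];
    by exists m; apply/act_ran.
- by move=> t m n; split=> [[]|].
- by move=> t m n; split=> [[]|].
Qed.

Definition action (s : sep_isg E) : word -> word -> Prop := act (irep s).

Lemma action_icls t m n : action (icls _ t) m n <-> act t m n.
Proof. exact/act_sound/irepP. Qed.

Lemma actionM (a b : sep_isg E) m n :
  action (a * b)%g m n <-> exists2 k, action a m k & action b k n.
Proof.
rewrite -{1}[a]irepK -{1}[b]irepK iclsM; exact: action_icls.
Qed.

Lemma action_ran (a : sep_isg E) m n :
  action (ran a) m n <-> m = n /\ exists k, action a m k.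
Proof.
rewrite ranE -{1 2}[a]irepK iclsV iclsM action_icls; exact: act_ran.
Qed.

Lemma action0 m n : ~ action zeros m n.
Proof. by move/(action_icls IZero). Qed.

Lemma action_vertex v m n :
  action (isg_vertex v) m n <-> [/\ node m, m = n & pend v0 m = v].
Proof. exact: (action_icls (IGen (inl v))). Qed.

Lemma action_edge e m n : action (isg_edge (inl e)) m n <-> arrow e m n.
Proof. exact: (action_icls (IGen (inr (inl e)))). Qed.

Lemma action_edgeV e m n : action (isg_edge (inr e)) m n <-> arrow e n m.
Proof. exact: (action_icls (IGen (inr (inr e)))). Qed.

End Model.

(** * Characters of the semilattice of idempotents *)

Section Character.
Variables (E : sep_graph) (q : sep_isg E) (L : seq (edg E)) (v0 : vtx E).
Local Notation word := (seq (dbl_edg E)).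
Hypothesis (qq : idems q) (q0 : q <> zeros).
Implicit Types (m n w : word) (e f g : edg E) (X : set (edg E)).
Local Open Scope group_scope.

Definition below w := q * ran (pth v0 w) = q.

(** The edge to be selected at [m] in the block [X]: the one that [q] forces if
    there is one, and otherwise an edge outside [L] if possible. *)
Definition preferred m X e : Prop :=
  [/\ X e, forall g, X g -> below (inl g :: m) -> e = g
    & below (inl e :: m) \/ (e \notin L \/ forall g, X g -> g \in L)].

Lemma below_block_uniq m X e f : sep X -> X e -> X f ->
  below (inl e :: m) -> below (inl f :: m) -> e = f.
Proof.
move=> sX Xe Xf qe qf; apply: contrapT => ef; apply: q0.
by rewrite -qf -[in LHS]qe -mulgA (ran_block_disjoint _ _ sX Xe Xf ef) muls0.
Qed.

Lemma preferred_ex m X : sep X -> exists e, preferred m X e.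
Proof.
move=> sX; have [[g Xg qg]|H] := pselect (exists2 g, X g & below (inl g :: m)).
  exists g; split=> //; last by left.
  by move=> h Xh qh; exact: below_block_uniq sX Xg Xh qg qh.
have noB e : forall g, X g -> below (inl g :: m) -> e = g.
  by move=> g Xg qg; case: H; exists g.
have [[g Xg gL]|H'] := pselect (exists2 g, X g & g \notin L).
  by exists g; split=> //; [exact: noB|right; left].
have [v vX] := sX; have [_ _ ne] := sep_atP v.
have [e Xe] := ne _ vX; exists e; split=> //; first exact: noB.
right; right => g Xg.
by apply/negPn/negP => gL; apply: H'; exists g.
Qed.

(** A single selection for all places and blocks. As an edge lies in only one
    block, the block can be left implicit in [pick]. *)
Lemma preferred_choice : exists pick : word -> edg E -> Prop,
  [/\ forall m X, sep_at (pend v0 m) X -> exists2 e, X e & pick m e,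
      forall m X e f, sep X -> X e -> X f -> pick m e -> pick m f -> e = f
    & forall m X e, sep X -> X e -> pick m e -> preferred m X e].
Proof.
have /choice[sel selP] : forall mX : word * set (edg E), exists o : option (edg E),
    sep mX.2 -> exists2 e, o = Some e & preferred mX.1 mX.2 e.
  move=> [m X]; have [sX|] := pselect (sep X); last by exists None.
  by have [e pe] := preferred_ex m sX; exists (Some e) => _; exists e.
have selE m X e : sep X -> X e ->
    (exists Y, [/\ sep Y, Y e & sel (m, Y) = Some e]) -> sel (m, X) = Some e.
  by move=> sX Xe [Y [sY Ye <-]]; rewrite (block_uniq sX sY Xe Ye).
exists (fun m e => exists Y, [/\ sep Y, Y e & sel (m, Y) = Some e]); split.
- move=> m X vX; have sX : sep X by exists (pend v0 m).
  have [e se [Xe _ _]] := selP (m, X) sX.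
  by exists e => //; exists X.
- move=> m X e f sX Xe Xf /(selE _ _ _ sX Xe) + /(selE _ _ _ sX Xf).
  by move=> -> [].
- move=> m X e sX Xe /(selE _ _ _ sX Xe) se.
  by have [e' +] := selP (m, X) sX; rewrite /= se => -[<-].
Qed.

Section Walk.
Variable pick : word -> edg E -> Prop.
Hypothesis pick_ex : forall m X, sep_at (pend v0 m) X -> exists2 e, X e & pick m e.
Hypothesis pick_uniq : forall m X e f, sep X -> X e -> X f ->
  pick m e -> pick m f -> e = f.
Hypothesis pick_pref : forall m X e, sep X -> X e -> pick m e -> preferred m X e.

Local Notation node := (node v0 pick).
Local Notation action := (action v0 pick).

Lemma eq_below w n : q * pth v0 w = q * pth v0 n -> below w <-> below n.
Proof. by move=> wn; rewrite /below (eq_ran qq wn). Qed.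

(** A path below which [q] lies can be walked in the selected tree. By induction
    the walk stands at a reduced word [n] with [q w = q n]; the next edge is then
    forced by [q], hence is the selected one, and it does not clash with the
    last letter of [n] since [q <> 0]. *)
Lemma walk w : below w -> exists n,
  [/\ node n, pend v0 n = pend v0 w, q * pth v0 w = q * pth v0 n
    & action (pth v0 w) [::] n].
Proof.
elim: w => [|x w IHw] qxw.
  by exists [::]; split=> //; apply/(action_vertex v0 pick_uniq).
have qw : below w by exact: le_ran_cons qxw.
have wx := le_ran_composable q0 qxw.
have [n [nn nw wn an]] := IHw qw.
have qn : below n by apply/(eq_below wn).
have xwn : q * pth v0 (x :: w) = q * pth v0 (x :: n) by rewrite /= !mulgA wn.
have qxn : below (x :: n) by apply/(eq_below xwn).
have nx : pend v0 n = dsrc x by rewrite nw.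
suff [n' [xn' ax]] : exists n', q * pth v0 (x :: n) = q * pth v0 n' /\
    action (isg_edge x) n n'.
  exists n'; rewrite xwn xn'; split=> //;
    last by apply/(actionM v0 pick_uniq); exists n.
    case: x ax {qxw wx xwn qxn nx xn'} => e.
      by move=> /(action_edge v0 pick_uniq)[].
    by move=> /(action_edgeV v0 pick_uniq)[].
  case: x ax {qxw wx xwn qxn nx xn'} => e.
    by move=> /(action_edge v0 pick_uniq)/arrow_rng.
  by move=> /(action_edgeV v0 pick_uniq)/arrow_src.
case: x nx qxn {qxw wx xwn} => e /= ne qxn.
- have [[m nE]|H] := pselect (exists m, n = inr e :: m).
    exists m; split; last first.
      apply/(action_edge v0 pick_uniq); split=> //; last by right.
      by move: nn; rewrite nE; case.
    rewrite nE /= -(mulgA (pth _ _)) isg_edgeVM.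
    move: nn; rewrite nE => -[_ <- _]; by rewrite pth_end.
  have [X eX Xe] := edge_block e; have sX : sep X by exists (src e).
  exists (inl e :: n); split=> //.
  apply/(action_edge v0 pick_uniq); split=> //; last by left.
  split=> //.
    have [g Xg pg] : exists2 g, X g & pick n g by apply: pick_ex; rewrite ne.
    by have [_ /(_ _ Xe qxn) <-] := pick_pref sX Xg pg.
  move=> f m Y nE sY Ye Yf; apply: q0.
  have /eqP/negbTE fe : f <> e by move=> fe; apply: H; exists m; rewrite -fe.
  rewrite -qxn nE ranE /= -(mulgA (pth _ _)) (isg_sepM sY Yf Ye) fe.
  by rewrite !(muls0, mul0s).
- have [[m nE]|H] := pselect (exists m, n = inl e :: m).
    exists m; split; last first.
      apply/(action_edgeV v0 pick_uniq); split=> //; last by left.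
      by move: nn; rewrite nE; case.
    rewrite nE /= -(mulgA (pth _ _)) -[isg_edge (inr e)](invs_edge (inl e)) -ranE.
    rewrite [RHS](@mul_ran_absorb _ q _ (isg_edge (inl e))) ?mulgA //.
    by move: qn; rewrite nE.
  exists (inr e :: n); split=> //.
  apply/(action_edgeV v0 pick_uniq); split=> //; last by right.
  by split=> // m nE; apply: H; exists m.
Qed.

Lemma below_character w : below w -> action (ran (pth v0 w)) [::] [::].
Proof.
by move=> /walk[n [_ _ _ an]]; apply/(action_ran v0 pick_uniq); split=> //; exists n.
Qed.

Lemma walk_complete w X : below w -> sep_at (pend v0 w) X ->
  exists f, [/\ X f, action (ran (pth v0 (inl f :: w))) [::] [::]
    & below (inl f :: w) \/ (f \notin L \/ forall g, X g -> g \in L)].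
Proof.
move=> qw wX; have sX : sep X by exists (pend v0 w).
have [n [nn nw wn an]] := walk qw; rewrite -nw in wX.
have fwn f : q * pth v0 (inl f :: w) = q * pth v0 (inl f :: n).
  by rewrite /= !mulgA wn.
have [[f [m [Xf nE]]]|[f [Xf pf af]]] := arrow_complete pick_ex nn wX.
  have qfw : below (inl f :: w).
    apply/(eq_below (fwn f)); have := (eq_below wn).1 qw.
    rewrite nE => qn; apply/(@eq_below _ m); last exact: le_ran_cons qn.
    rewrite /= -(mulgA (pth _ _)) isg_edgeVM.
    by move: nn; rewrite nE => -[_ <- _]; rewrite pth_end.
  by exists f; split=> //; [exact: below_character|left].
exists f; split=> //.
  apply/(action_ran v0 pick_uniq); split=> //; exists (inl f :: n).
  by apply/(actionM v0 pick_uniq); exists n => //; apply/(action_edge v0 pick_uniq).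
by have [_ _] := pick_pref sX Xf pf; rewrite /below (eq_ran qq (fwn f)).
Qed.

End Walk.
End Character.

(** The character says which elements fix the root of the selected tree. The last
    clause expresses that this tree is complete, and that its choices avoid [L]
    wherever [q] and the size of the block allow it. *)
Lemma separating_character (E : sep_graph) (q : sep_isg E) (L : seq (edg E)) :
    idems q -> q <> zeros ->
  exists chi : sep_isg E -> Prop,
    [/\ chi q, ~ chi zeros, forall a b, chi a -> chi b -> chi (a * b)%g
      & forall v w X, (q * ran (pth v w))%g = q -> sep_at (pend v w) X ->
          exists f, [/\ X f, chi (ran (pth v (inl f :: w)))
            & (q * ran (pth v (inl f :: w)))%g = q \/
              (f \notin L \/ forall g, X g -> g \in L)]].
Proof.
move=> qq q0; have [v0 [w0 qE]] := idem_pth qq q0.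
have [pick [pick_ex pick_uniq pick_pref]] := preferred_choice L v0 q0.
have q0w : below q v0 w0 by rewrite /below -qE.
exists (fun s => action v0 pick s [::] [::]); split.
- rewrite {1}qE; exact: (below_character qq q0 pick_ex pick_uniq pick_pref q0w).
- exact: action0 pick_uniq _ _.
- by move=> a b aa ab; apply/(actionM v0 pick_uniq); exists [::].
- move=> v w X qw.
  (* A nonzero element lies below only one vertex. *)
  suff vv : v = v0.
    rewrite vv in qw *.
    exact: (walk_complete qq q0 pick_ex pick_uniq pick_pref).
  apply/eqP/negPn/negP => /negbTE vv; apply: q0.
  have nil u w' : (q * ran (pth u w'))%g = q -> (q * isg_vertex u)%g = q.
    move=> qu; rewrite -[isg_vertex u](idem_ranE (idem_vertex u)).
    by apply: (le_ran_mull (b := pth u w')); rewrite pth_start.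
  by rewrite -(nil _ _ q0w) -(nil _ _ qw) -mulgA isg_vertexM vv muls0.
Qed.

(** * Joins of images *)

Section Joins.
Variables (K : comPzRingType) (conj : {rmorphism K -> K}) (A : starAlgType conj).
Variables (T : eqType) (F : T -> A).
Implicit Types (r : seq T) (s : A).

Lemma mul_join_fix s r : (forall z, z \in r -> (s * F z)%g = F z) ->
  (s * \big[@vee K conj A/0%R]_(z <- r) F z)%g =
  \big[@vee K conj A/0%R]_(z <- r) F z.
Proof.
elim: r => [|z r IHr] sF; first by rewrite big_nil samul0r.
have sJ := IHr (fun y ry => sF y (mem_behead (s := z :: r) ry)).
rewrite big_cons; set J := (\big[_/_]_(y <- r) F y) in sJ *.
by rewrite /vee samulBr samulDr mulgA sJ sF ?mem_head.
Qed.

Lemma mul_join_absorb r z :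
  (forall y, y \in r -> (F y * F y)%g = F y) ->
  (forall y y', y \in r -> y' \in r -> (F y * F y')%g = (F y' * F y)%g) ->
  z \in r -> (F z * \big[@vee K conj A/0%R]_(y <- r) F y)%g = F z.
Proof.
elim: r => [//|y r IHr] idF comF yrz; rewrite big_cons.
set J := (\big[_/_]_(t <- r) F t).
rewrite /vee samulBr samulDr mulgA; move: yrz; rewrite inE => /predU1P[->|rz].
  by rewrite idF ?mem_head // addrK.
have sub t : t \in r -> t \in y :: r by rewrite inE orbC => ->.
rewrite (comF z y) ?mem_head ?sub // -mulgA IHr //.
  by rewrite [X in (X - _)%R]addrC addrK.
  by move=> t /sub; exact: idF.
by move=> t t' /sub rt /sub; exact: comF.
Qed.

End Joins.

Section SumMul.
Variables (K : comPzRingType) (conj : {rmorphism K -> K}) (A : starAlgType conj).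
Variables (T : Type) (F : T -> A).

Lemma samul_suml (r : seq T) (a : A) :
  ((\sum_(i <- r) F i)%R * a)%g = (\sum_(i <- r) (F i * a)%g)%R.
Proof.
elim: r => [|i r IHr]; first by rewrite !big_nil samul0l.
by rewrite !big_cons samulDl IHr.
Qed.

Lemma samul_sumr (r : seq T) (a : A) :
  (a * (\sum_(i <- r) F i)%R)%g = (\sum_(i <- r) (a * F i)%g)%R.
Proof.
elim: r => [|i r IHr]; first by rewrite !big_nil samul0r.
by rewrite !big_cons samulDr IHr.
Qed.

End SumMul.

Section StarHom.
Variables (S : invSemigroup0Type) (K : comPzRingType) (conj : {rmorphism K -> K}).
Variables (A : starAlgType conj) (pi : S -> A).
Hypothesis pi_hom : star_sg_hom pi.

Lemma hom_idem p : idems p -> (pi p * pi p)%g = pi p.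
Proof. by move=> pp; rewrite -pi_hom.1 pp. Qed.

Lemma hom_idemC p q : idems p -> idems q -> (pi p * pi q)%g = (pi q * pi p)%g.
Proof. by move=> pp qq; rewrite -!pi_hom.1 idemC. Qed.

Lemma hom_ran a : pi (ran a) = (pi a * star (pi a))%g.
Proof. by rewrite ranE pi_hom.1 pi_hom.2. Qed.

(** Zero is covered by the empty set. *)
Lemma tight_zero : tight pi -> pi zeros = 0%R.
Proof.
have cov : idem_cover (zeros : S) fset0.
  by split=> // q _; rewrite /idem_le mul0s => <-.
by move=> /(_ _ _ (mul0s _) cov) <-; rewrite big_seq big_pred0.
Qed.

End StarHom.

(** * Blocks are covers *)

Section Blocks.
Variable E : sep_graph.
Local Notation S := (sep_isg E).
Implicit Types (v : vtx E) (X : set (edg E)).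

Lemma sep_at_sep v X : sep_at v X -> sep X.
Proof. by exists v. Qed.

(** A character that contains [q] selects an edge [f] of the block, and then it
    contains the product of [q] with the idempotent of [f]. *)
Lemma block_cover v X : sep_at v X -> finite_set X ->
  idem_cover (isg_vertex v) [fset ran (isg_edge (inl e) : S) | e in fset_set X]%fset.
Proof.
move=> vX finX; split=> [z|q qq qv q0].
  move=> /imfsetP[e /= + ->]; rewrite in_fset_set // inE => Xe.
  split; first exact: idem_ran.
  by rewrite /idem_le ranE mulgA -(sep_src vX Xe) (isg_srcM (inl e)).
have qv' : (q * ran (pth v [::]))%g = q.
  by rewrite /= (idem_ranE (idem_vertex v)); apply/idem_leE => //;
    exact: idem_vertex.
have [chi [chiq chi0 chiM /(_ _ _ _ qv' vX)[f [Xf chif _]]]] :=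
  separating_character [::] qq q0.
exists (ran (isg_edge (inl f))).
  by apply/imfsetP; exists f => //=; rewrite in_fset_set // inE.
rewrite /= -(sep_src vX Xf) (isg_srcM (inl f)) in chif.
by move=> fq; apply: chi0; rewrite -fq; exact: chiM.
Qed.

(** The sum [s] fixes each of its terms, hence their join, which is the image of
    [v] by tightness; as the terms lie below [v], also [s] times the image of
    [v] is [s]. Thus the sum over
    edges is never compared with a join over idempotents term by term. *)
Lemma tight_sck2 (K : comPzRingType) (conj : {rmorphism K -> K})
    (A : starAlgType conj) (pi : S -> A) v X :
  star_sg_hom pi -> tight pi -> sep_at v X -> finite_set X ->
  (\sum_(e <- fset_set X) pi (ran (isg_edge (inl e))) = pi (isg_vertex v))%R.
Proof.
move=> hpi tpi vX finX; have tv := tpi _ _ (idem_vertex v) (block_cover vX finX).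
set s := (\sum_(e <- _) _)%R.
have fixJ : (s * pi (isg_vertex v))%g = pi (isg_vertex v).
  rewrite -tv; apply: mul_join_fix => z /imfsetP[f /= Xf ->].
  rewrite /s samul_suml (big_rem f) //= -hpi.1 idem_ran big1_seq ?addr0 //.
  move=> e /andP[_]; rewrite mem_rem_uniq ?fset_uniq // !inE => /andP[/eqP ef Xe].
  rewrite -hpi.1; move: Xe Xf; rewrite !in_fset_set // !inE => Xe Xf.
  have := ran_block_disjoint v [::] (sep_at_sep vX) Xe Xf ef.
  rewrite /= -{1}(sep_src vX Xe) -(sep_src vX Xf) !(isg_srcM (inl _)) => ->.
  exact: tight_zero.
rewrite -fixJ /s samul_suml; apply: eq_big_seq => e.
rewrite in_fset_set // inE => Xe; rewrite -hpi.1 -(sep_src vX Xe).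
rewrite (idemC (idem_ran _) (idem_vertex _)) ranE mulgA.
by rewrite (isg_srcM (inl e)).
Qed.

End Blocks.

(** * Tight homomorphisms extend *)

Section Extension.
Variables (E : sep_graph) (K : comPzRingType) (conj : {rmorphism K -> K}).
Variables (A : starAlgType conj) (pi : sep_isg E -> A).
Hypothesis pi_hom : star_sg_hom pi.
Local Notation V := (isg_vertex (E := E)).
Local Notation G := (isg_edge (E := E)).
Local Open Scope ring_scope.

Lemma star_alg_hom0 (B C : starAlgType conj) (f : B -> C) :
  star_alg_hom f -> f 0 = 0.
Proof.
move=> [fl _ _]; have := fl 1 0 0; rewrite !scale1r addr0 => e.
by apply: (@addrI _ (f 0)); rewrite -e addr0.
Qed.

Lemma star_alg_homD (B C : starAlgType conj) (f : B -> C) :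
  star_alg_hom f -> {morph f : x y / x + y}.
Proof. by move=> [fl _ _] x y; rewrite -[x]scale1r fl !scale1r. Qed.

Lemma star_alg_homB (B C : starAlgType conj) (f : B -> C) :
  star_alg_hom f -> {morph f : x y / x - y}.
Proof.
move=> hf x y; apply: (addIr (f y)); rewrite subrK -(star_alg_homD hf).
by rewrite subrK.
Qed.

Lemma star_alg_hom_sum (B C : starAlgType conj) (f : B -> C) (I : Type)
    (r : seq I) (F : I -> B) : star_alg_hom f ->
  f (\sum_(i <- r) F i) = \sum_(i <- r) f (F i).
Proof.
move=> hf; elim: r => [|i r IHr]; first by rewrite !big_nil star_alg_hom0.
by rewrite !big_cons star_alg_homD // IHr.
Qed.

Lemma leavitt_extension : pi zeros = 0 ->
    (forall v X, sep_at v X -> finite_set X ->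
      \sum_(e <- fset_set X) pi (ran (G (inl e))) = pi (V v)) ->
  exists f : leavitt conj E -> A,
    [/\ star_alg_hom f, forall v, f (leavitt_vertex conj v) = pi (V v)
      & forall e, f (leavitt_edge conj e) = pi (G (inl e))].
Proof.
move=> pi0 sck2.
pose g (x : vtx E + edg E) : A :=
  match x with inl v => pi (V v) | inr e => pi (G (inl e)) end.
have [f [[hf fg] _]] := free_star_universal g.
have [fl fM fS] := hf.
have fv v : f (sgen conj (inl v)) = pi (V v) by exact: fg.
have fe e : f (sgen conj (inr e)) = pi (G (inl e)) by exact: fg.
have piV e : star (pi (G (inl e))) = pi (G (inr e)).
  by rewrite -pi_hom.2 invs_edge.
have frel x y : leavitt_rel x y -> f x = f y.
  case=> {x y} [v|v w|e|e|e|e|X e e' sX Xe Xe'|v X vX finX];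
      rewrite ?fM ?fS ?fv ?fe ?piV.
  - by rewrite -pi_hom.2 (idemV (idem_vertex v)).
  - rewrite -pi_hom.1 isg_vertexM; case: eqP => _; first by rewrite fv.
    by rewrite (star_alg_hom0 hf).
  - by rewrite -pi_hom.1 (isg_srcM (inl e)).
  - by rewrite -pi_hom.1 (isg_rngM (inl e)).
  - by rewrite -pi_hom.1 (isg_rngM (inr e)).
  - by rewrite -pi_hom.1 (isg_srcM (inr e)).
  - rewrite -pi_hom.1 (isg_sepM sX) //; case: eqP => _; first by rewrite fv.
    by rewrite (star_alg_hom0 hf).
  - rewrite -(sck2 v X vX finX) fsbig_finite //= (star_alg_hom_sum _ _ hf).
    by apply: eq_bigr => e _; rewrite fM fS fe hom_ran.
have fG d : (exists x y, leavitt_rel x y /\ d = x - y) -> f d = 0.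
  by move=> [x [y [/frel xy ->]]]; rewrite (star_alg_homB hf) xy subrr.
have [h [[hh hq] _]] := star_quot_universal hf fG.
exists h; split=> // [v|e].
  by rewrite -fv -hq.
by rewrite -fe -hq.
Qed.

Lemma tame_extension : pi zeros = 0 ->
    (forall v X, sep_at v X -> finite_set X ->
      \sum_(e <- fset_set X) pi (ran (G (inl e))) = pi (V v)) ->
  exists phi : tame_leavitt conj E -> A,
    star_alg_hom phi /\ forall s, pi s = phi (tame_canon conj s).
Proof.
move=> pi0 sck2; have [f [hf fv fe]] := leavitt_extension pi0 sck2.
have [fl fM fS] := hf.
have img x : leavitt_sg x -> exists s, f x = pi s.
  elim=> {x} [x [[v _ <-]|[e _ <-]]|x y _ [s fx] _ [t fy]|x _ [s fx]].
  - by exists (V v).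
  - by exists (G (inl e)).
  - by exists (s * t)%g; rewrite fM fx fy pi_hom.1.
  - by exists (invs s); rewrite fS fx pi_hom.2.
have fG c : (exists x y, [/\ leavitt_sg x, leavitt_sg y
    & c = commutator (x * star x)%g (y * star y)%g]) -> f c = 0.
  move=> [x [y [/img[s fx] /img[t fy] ->]]].
  rewrite (star_alg_homB hf) !fM !fS fx fy -!hom_ran //.
  by rewrite (hom_idemC pi_hom (idem_ran s) (idem_ran t)) subrr.
have [h [[hh hq] _]] := star_quot_universal hf fG.
have [_ hM hS] := hh.
exists h; split=> // s; rewrite -[s]irepK.
elim: (irep s) => [[v|[e|e]]||t IHt u IHu|t IHt].
- by rewrite -[icls _ _]/(V v) tame_canon_vertex -fv -hq.
- by rewrite -[icls _ _]/(G (inl e)) tame_canon_edge -fe -hq.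
- rewrite -[icls _ _]/(G (inr e)) tame_canon_edgeV hS.
  by rewrite -[inr e]/(flip (inl e)) -invs_edge pi_hom.2 -fe -hq.
- by rewrite -[icls _ _]/zeros tame_canon0 pi0 (star_alg_hom0 hh).
- by rewrite -iclsM pi_hom.1 (tame_canon_hom conj E).1 hM IHt IHu.
- by rewrite -iclsV pi_hom.2 (tame_canon_hom conj E).2 hS IHt.
Qed.

Lemma leavitt_relE (x y : free_star conj (vtx E + edg E)) :
  leavitt_rel x y -> leavitt_cls x = leavitt_cls y.
Proof. by move=> xy; apply/qclsP/Sid_gen; exists x, y. Qed.

(** The relation (SCK2), transported along both quotient maps. *)
Lemma tame_sck2 v X : sep_at v X -> finite_set X ->
  \sum_(e <- fset_set X) tame_canon conj (ran (G (inl e))) =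
  tame_canon conj (V v).
Proof.
move=> vX finX; rewrite tame_canon_vertex /tame_vertex /leavitt_vertex.
rewrite -(leavitt_relE (Lrel_SCK2 conj vX finX)).
rewrite fsbig_finite //= (star_alg_hom_sum _ _ (leavitt_cls_hom conj E)).
rewrite (star_alg_hom_sum _ _ (tame_cls_hom conj E)).
apply: eq_bigr => e _; rewrite hom_ran; last exact: tame_canon_hom.
have [_ lM lS] := leavitt_cls_hom conj E; have [_ tM tS] := tame_cls_hom conj E.
by rewrite tame_canon_edge lM lS tM tS.
Qed.

End Extension.

(** * Homomorphisms that extend are tight *)

Section Gaps.
Variable E : sep_graph.
Local Notation S := (sep_isg E).
Local Notation word := (seq (dbl_edg E)).
Implicit Types (q p : S) (v : vtx E) (w : word) (e f : edg E).
Local Open Scope group_scope.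

(** The number of prefixes of [w] that [q] does not contain: how much of the path
    [w] still lies outside of the tree of [q]. *)
Fixpoint gap q v w : nat :=
  (~~ `[< below q v w >] + if w is _ :: w' then gap q v w' else 0)%N.

Lemma below_trans p q v w : p * q = p -> below q v w -> below p v w.
Proof. by rewrite /below => pq qw; rewrite -pq -mulgA qw. Qed.

Lemma gap_leq p q v w : p * q = p -> (gap p v w <= gap q v w)%N.
Proof.
move=> pq.
have le w' : (~~ `[< below p v w' >] <= ~~ `[< below q v w' >])%N.
  case: asboolP => //= np; case: asboolP => // qw'.
  by case: np; exact: below_trans pq qw'.
by elim: w => [|x w IHw] /=; [rewrite !addn0|exact: leq_add].
Qed.

Lemma gap_ltn p q v w w' : p * q = p ->
  below p v w' -> ~ below q v w' -> (gap p v (w ++ w') < gap q v (w ++ w'))%N.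
Proof.
move=> pq pw' qw'; elim: w => [|x w IHw].
  case: w' pw' qw' => [|x w'] pw' qw' /=; rewrite (asboolT pw') (asboolF qw') //=.
  by rewrite add0n add1n ltnS gap_leq.
rewrite cat_cons /= -addnS leq_add //.
case: asboolP => //= np; case: asboolP => // qx.
by case: np; exact: below_trans pq qx.
Qed.

(** A path cannot leave the tree of [q] along an inverse edge, because such a
    step is free ([ran_cons_inv]). *)
Lemma frontier q v w : idems q -> q * ran (pth v w) <> zeros -> ~ below q v w ->
  exists e w1 w2, [/\ w = w2 ++ inl e :: w1, pend v w1 = src e,
    below q v w1 & ~ below q v (inl e :: w1)].
Proof.
move=> qq; elim: w => [|x w IHw] qw0 nqw.
  have /(idem_pth qq)[u [w qE]] : q <> zeros.
    by move=> q0; apply: qw0; rewrite q0 mul0s.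
  have qu : q * isg_vertex u = q.
    rewrite -[isg_vertex u](idem_ranE (idem_vertex u)).
    by apply: (le_ran_mull (b := pth u w)); rewrite pth_start -qE.
  move: qw0 nqw; rewrite /below /= (idem_ranE (idem_vertex v)) -qu -mulgA.
  rewrite isg_vertexM.
  by case: eqP => _; rewrite ?muls0.
have qw : q * ran (pth v w) <> zeros.
  by move=> q0; apply: qw0; rewrite /= -ran_mull mulgA q0 mul0s.
have [bw|nbw] := pselect (below q v w); last first.
  have [e [w1 [w2 [-> ? ? ?]]]] := IHw qw nbw.
  by exists e, w1, (x :: w2).
have wx : pend v w = dsrc x.
  by apply: contrapT => ne; apply: qw0; rewrite pth_cons_eq0 // ran0 muls0.
case: x wx qw0 nqw => e /= we qw0 nqw; first by exists e, w, [::].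
by case: nqw; rewrite /below ran_cons_inv.
Qed.

End Gaps.

Section Refinement.
Variables (E : sep_graph) (K : comPzRingType) (conj : {rmorphism K -> K}).
Variables (A : starAlgType conj) (pi : sep_isg E -> A).
Local Notation S := (sep_isg E).
Local Notation word := (seq (dbl_edg E)).
Local Notation V := (isg_vertex (E := E)).
Local Notation G := (isg_edge (E := E)).
Hypothesis pi_hom : star_sg_hom pi.
Hypothesis pi0 : pi zeros = 0%R.
Hypothesis sck2 : forall v X, sep_at v X -> finite_set X ->
  (\sum_(e <- fset_set X) pi (ran (G (inl e))) = pi (V v))%R.
Implicit Types (q p z : S) (v : vtx E) (w : word) (e f : edg E).
Local Open Scope group_scope.

(** Insert the relation for a finite block behind the path [w]. *)
Lemma refine q v w X : below q v w -> sep_at (pend v w) X -> finite_set X ->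
  pi q = (\sum_(f <- fset_set X) pi (q * ran (pth v (inl f :: w)))%g)%R.
Proof.
move=> qw wX finX.
rewrite -[in LHS]qw ranE -(pth_end v w) !pi_hom.1 -(sck2 wX finX).
rewrite !(samul_suml, samul_sumr); apply: eq_bigr => f _.
by rewrite -!pi_hom.1 /= ranM pth_end.
Qed.

Variables (Z : seq S) (vw : S -> vtx E * word).
Hypothesis Zpth : forall z, z \in Z -> z <> zeros -> z = ran (pth (vw z).1 (vw z).2).

(** An element of [Z] disjoint from [q] costs nothing, whatever its path. *)
Definition cost q z : nat :=
  if `[< q * z = zeros >] then 0%N else gap q (vw z).1 (vw z).2.

Lemma cost_leq p q z : idems p -> idems q -> p * q = p -> (cost p z <= cost q z)%N.
Proof.
move=> pp qq pq; rewrite /cost; case: asboolP => // pz; case: asboolP => [qz|_].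
  by case: pz; rewrite -pq -mulgA qz muls0.
exact: gap_leq.
Qed.

Lemma exit_block q z : idems q -> z \in Z -> q * z <> zeros -> q * z <> q ->
  exists e w1 w2 X, [/\ (vw z).2 = w2 ++ inl e :: w1, sep_at (pend (vw z).1 w1) X,
    X e, below q (vw z).1 w1 & ~ below q (vw z).1 (inl e :: w1)].
Proof.
move=> qq Zz qz0 qz; have z0 : z <> zeros by move=> z0; apply: qz0; rewrite z0 muls0.
have zE := Zpth Zz z0; rewrite zE in qz0 qz.
have [e [w1 [w2 [wE we ? ?]]]] := frontier qq qz0 qz.
have [X eX Xe] := edge_block e.
by exists e, w1, w2, X; rewrite we.
Qed.

Lemma exit_other z e f w1 w2 X : z \in Z ->
  (vw z).2 = w2 ++ inl e :: w1 -> sep X -> X e -> X f -> f <> e ->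
  ran (pth (vw z).1 (inl f :: w1)) * z = zeros.
Proof.
move=> Zz wE sX Xe Xf fe.
have [->|z0] := pselect (z = zeros); first by rewrite muls0.
have ze : ran (pth (vw z).1 (inl e :: w1)) * z = z.
  rewrite {2 3}(Zpth Zz z0) wE; elim: w2 {wE} => [|x w2 IH]; first exact: idem_ran.
  by rewrite cat_cons [pth _ (x :: _)]/= -ran_mull mulgA IH.
have := mul0s z; rewrite -(ran_block_disjoint (vw z).1 w1 sX Xf Xe fe).
by rewrite -mulgA ze.
Qed.

(** Restricting [q] to an edge [f] of the block through which [z] leaves it
    follows [z] one step further if [f] is the edge of [z], and makes [q]
    disjoint from [z] otherwise. *)
Lemma refine_cost q z e f w1 w2 X : idems q -> z \in Z -> q * z <> zeros ->
  (vw z).2 = w2 ++ inl e :: w1 -> sep X -> X e -> X f ->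
  ~ below q (vw z).1 (inl e :: w1) ->
  (cost (q * ran (pth (vw z).1 (inl f :: w1)))%g z < cost q z)%N.
Proof.
move=> qq Zz qz wE sX Xe Xf nqe; rewrite /cost (asboolF qz).
set p := q * _; have pq : p * q = p.
  by rewrite /p -mulgA (idemC (idem_ran _) qq) mulgA qq.
have pf : below p (vw z).1 (inl f :: w1) by rewrite /below /p -mulgA idem_ran.
have [fe|fe] := pselect (f = e).
  rewrite fe in pf; have lt := gap_ltn w2 pq pf nqe; rewrite -wE in lt.
  by case: asboolP => // _; exact: leq_ltn_trans lt.
rewrite asboolT; last by rewrite /p -mulgA (exit_other Zz wE sX Xe Xf fe) muls0.
have z0 : below zeros (vw z).1 (inl e :: w1) by rewrite /below mul0s.
have := gap_ltn w2 (mul0s q) z0 nqe; rewrite -wE.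
exact: leq_ltn_trans.
Qed.

(** The edges to be avoided by a character. They are taken from the whole paths,
    so that the list does not depend on where the paths leave [q]. *)
Definition letters : seq (edg E) :=
  pmap (fun x => if x is inl e then Some e else None)
    (flatten [seq (vw z).2 | z <- Z]).

Lemma mem_letters z e w1 w2 :
  z \in Z -> (vw z).2 = w2 ++ inl e :: w1 -> e \in letters.
Proof.
move=> Zz wE; rewrite mem_pmap; apply/mapP; exists (inl e) => //.
by apply/flattenP; exists (vw z).2; [exact: map_f|rewrite wE mem_cat mem_head orbT].
Qed.

(** If every element of [Z] that meets [q] leaves the tree of [q] through an
    infinite block, then one character containing [q] can take an edge avoiding
    [letters] at each of these places. *)
Lemma avoid q : idems q -> q <> zeros ->
  (forall z e w1 w2 X, z \in Z -> q * z <> zeros -> (vw z).2 = w2 ++ inl e :: w1 ->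
     sep_at (pend (vw z).1 w1) X -> X e -> below q (vw z).1 w1 ->
     ~ below q (vw z).1 (inl e :: w1) -> ~ finite_set X) ->
  (forall z, z \in Z -> q * z <> q) ->
  exists p, [/\ idems p, p * q = p, p <> zeros & forall z, z \in Z -> p * z = zeros].
Proof.
move=> qq q0 inf nle.
have [chi [chiq chi0 chiM chiC]] := separating_character letters qq q0.
suff /(_ Z (fun z => id))[p [pp pq chip pZ]] : forall Z' : seq S, {subset Z' <= Z} ->
    exists p, [/\ idems p, p * q = p, chi p & forall z, z \in Z' -> p * z = zeros].
  by exists p; split=> // p0; apply: chi0; rewrite -p0.
elim=> [|z Z' IH] sub; first by exists q; split.
have [p [pp pq chip pZ]] : exists p,
    [/\ idems p, p * q = p, chi p & forall z, z \in Z' -> p * z = zeros].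
  by apply: IH => y Z'y; apply: sub; rewrite inE Z'y orbT.
have Zz : z \in Z by apply: sub; rewrite mem_head.
have [qz|qz] := pselect (q * z = zeros).
  exists p; split=> // y; rewrite inE => /predU1P[->|/pZ//].
  by rewrite -pq -mulgA qz muls0.
have [e [w1 [w2 [X [wE wX Xe qw nqe]]]]] := exit_block qq Zz qz (nle _ Zz).
have infX := inf _ _ _ _ _ Zz qz wE wX Xe qw nqe.
have [f [Xf chif fP]] := chiC _ _ _ qw wX.
have sX := sep_at_sep wX.
have fe : f <> e.
  move=> fe; rewrite fe in fP; case: fP => [//|[]].
    by rewrite (mem_letters Zz wE).
  move=> XL; apply: infX; apply: (@sub_finite_set _ _ [set` letters]) => //.
have fz := exit_other Zz wE sX Xe Xf fe.
exists (p * ran (pth (vw z).1 (inl f :: w1))); split.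
- by apply: idem_mul => //; exact: idem_ran.
- by rewrite -mulgA (idemC (idem_ran _) qq) mulgA pq.
- exact: chiM.
- move=> y; rewrite inE => /predU1P[->|/pZ py]; first by rewrite -mulgA fz muls0.
  by rewrite (idemC pp (idem_ran _)) -mulgA py muls0.
Qed.

(** Induction on the total cost of [q]. The statement is additive in [pi q], so
    it can be checked on the pieces of a refinement. *)
Lemma cover_fix (a : A) (absorb : forall z, z \in Z -> pi z * a = pi z) q :
  idems q ->
  (forall p, idems p -> p * q = p -> p <> zeros ->
     exists2 z, z \in Z & p * z <> zeros) ->
  pi q * a = pi q.
Proof.
have [n] := ubnP (\sum_(z <- Z) cost q z).
elim: n q => // n IHn q leq_n qq cov.
have [->|q0] := pselect (q = zeros); first by rewrite pi0 samul0l.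
have [[z Zz qz]|nle] := pselect (exists2 z, z \in Z & q * z = q).
  by rewrite -qz pi_hom.1 -mulgA absorb.
have nle' z : z \in Z -> q * z <> q by move=> Zz qz; apply: nle; exists z.
have [[z [e [w1 [w2 [X [[Zz qz wE wX Xe] [qw nqe finX]]]]]]]|nfin] :=
  pselect (exists z e w1 w2 X, [/\ z \in Z, q * z <> zeros,
     (vw z).2 = w2 ++ inl e :: w1, sep_at (pend (vw z).1 w1) X & X e] /\
     [/\ below q (vw z).1 w1,
     ~ below q (vw z).1 (inl e :: w1) & finite_set X]).
- rewrite (refine qw wX finX) samul_suml; apply: eq_big_seq => f.
  rewrite in_fset_set // inE => Xf.
  set p := q * _; have pp : idems p by apply: idem_mul => //; exact: idem_ran.
  have pq : p * q = p by rewrite /p -mulgA (idemC (idem_ran _) qq) mulgA qq.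
  apply: IHn => // [|p' pp' p'p]; last first.
    by apply: cov => //; rewrite -p'p -mulgA pq.
  rewrite ltnS in leq_n; apply: leq_trans leq_n.
  rewrite (big_rem z Zz) [leqRHS](big_rem z Zz) /= -addSn.
  apply: leq_add; last by apply: leq_sum => y _; exact: cost_leq.
  exact: refine_cost qq Zz qz wE (sep_at_sep wX) Xe Xf nqe.
- have [|p [pp pq p0 pZ]] := avoid qq q0 _ nle'.
    move=> z e w1 w2 X Zz qz wE wX Xe qw nqe finX.
    by apply: nfin; exists z, e, w1, w2, X.
  have [z Zz []] := cov p pp pq p0.
  exact: pZ.
Qed.

End Refinement.

(** The join [J] of the images of a cover of [p] satisfies [pi p J = J], since the
    cover lies below [p]; the equality [pi p J = pi p] is [cover_fix]. *)
Lemma sck2_tight (E : sep_graph) (K : comPzRingType) (conj : {rmorphism K -> K})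
    (A : starAlgType conj) (pi : sep_isg E -> A) :
  star_sg_hom pi -> pi zeros = 0%R ->
  (forall v X, sep_at v X -> finite_set X ->
    (\sum_(e <- fset_set X) pi (ran (isg_edge (inl e))) = pi (isg_vertex v))%R) ->
  tight pi.
Proof.
move=> hpi pi0 sck2 p Z pp [Zp cov].
set J := (\big[_/_]_(z <- Z) pi z).
have Zi z : z \in Z -> idems z by move=> /Zp[].
have absorb z : z \in enum_fset Z -> (pi z * J)%g = pi z.
  apply: mul_join_absorb => [y Zy|y y' Zy Zy'].
    by apply: hom_idem => //; exact: Zi.
  by apply: hom_idemC => //; exact: Zi.
have JE : (pi p * J)%g = J.
  by apply: mul_join_fix => z /Zp[_ zp]; rewrite -hpi.1 zp.
have [p0|p0] := pselect (p = zeros).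
  by rewrite -JE p0 pi0 samul0l.
have [v0 _] := idem_pth pp p0.
have /choice[vw vwP] : forall z : sep_isg E, exists vw : vtx E * seq (dbl_edg E),
    idems z -> z <> zeros -> z = ran (pth vw.1 vw.2).
  move=> z; have [zz|] := pselect (idems z); last by exists (v0, [::]).
  have [->|z0] := pselect (z = zeros); first by exists (v0, [::]).
  by have [v [w zE]] := idem_pth zz z0; exists (v, w).
rewrite -JE; apply: (cover_fix hpi pi0 sck2 (vw := vw) _ absorb pp).
  by move=> z /Zi; exact: vwP.
move=> q qq qp q0.
have [|z Zz zq] := cov q qq _ q0; first by rewrite /idem_le (idemC pp qq).
by exists z => //; rewrite (idemC qq (Zi _ Zz)).
Qed.

Theorem theorem6p19 (E : sep_graph) (noiso : forall v : vtx E, ~ isolated v)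
    (K : comPzRingType) (conj : {rmorphism K -> K}) (conjK : involutive conj)
    (A : starAlgType conj) (pi : sep_isg E -> A) (pi_hom : star_sg_hom pi) :
  tight pi <->
  exists phi : tame_leavitt conj E -> A,
    star_alg_hom phi /\ forall s : sep_isg E, pi s = phi (tame_canon conj s).
Proof.
split=> [tpi|[phi [hphi piE]]].
  apply: tame_extension => //; first exact: tight_zero.
  by move=> v X vX finX; exact: tight_sck2.
have pi0 : pi zeros = 0%R by rewrite piE tame_canon0 star_alg_hom0.
apply: sck2_tight => // v X vX finX.
rewrite piE -(tame_sck2 conj vX finX) (star_alg_hom_sum _ _ hphi).
by apply: eq_bigr => e _; rewrite piE.
Qed.
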